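(* Let $\alpha=(\alpha_n)_{n\ge1}$ and $\beta=(\beta_n)_{n\ge1}$ be sequences of non-negative real numbers such that there exists $B\in\mathbb{R}_+$ with $|\alpha_{n+1}-\alpha_n|\le B$ and $|\beta_{n+1}-\beta_n|\le B$ for all $n\ge1$, and such that there exist $0\le\gamma\le1/2$ and $K>0$ with $0\le\alpha_n,\beta_n\le Kn^\gamma$ for all $n\ge1$. Fix an initial condition $u^0\in\mathcal{Q}$ with $u^0_1>0$ and a time $\tau>0$. Suppose also that there exists $k\ge2$ such that $u^0_k>0$. Let $u(t)$ be the solution of the Becker--Döring problem with initial condition $u^0$, and let $u^n=S_{\Delta t}(u^{n-1})$, $n\ge1$, be the iterates of the splitting map $S_{\Delta t}$ started from $u^0$ (see context). Then there exist a constant $L(\tau,u^0)\in\mathbb{R}_+$ and a time step $\Delta t_*>0$ such that $$\forall\,\Delta t\in(0,\Delta t_*],\quad\forall\,0\le n\le\frac{\tau}{\Delta t},\qquad \|u(n\Delta t)-u^n\|\le L(\tau,u^0)\,\Delta t.$$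
   Context: $\mathbb{R}_+=[0,\infty)$, $\mathbb{N}^*=\{1,2,\dots\}$, $\mathcal{H}=\ell^2(\mathbb{N}^*,\mathbb{R})$ with its natural norm $\|\cdot\|$, and $\mathcal{Q}=\{u\in\mathcal{H}: u_n\ge0\ \forall n\ge1,\ \sum_{n\ge1}nu_n<+\infty\}$. Becker--Döring problem: $u(0)=u^0$ and $$\frac{du_1}{dt}=-2\beta_1u_1^2-\sum_{n\ge2}\beta_nu_nu_1+\sum_{n\ge2}\alpha_nu_n+\alpha_2u_2,$$ $$\frac{du_n}{dt}=\beta_{n-1}u_{n-1}u_1-(\beta_nu_1+\alpha_n)u_n+\alpha_{n+1}u_{n+1},\quad n\ge2.$$ For $u^0\in\mathcal{Q}$ it has a unique global classical solution $u\in\mathcal{C}^0(\mathbb{R}_+,\mathcal{Q})\cap\mathcal{C}^1(\mathbb{R}_+,\mathcal{H})$. Splitting. First sub-dynamics: $\varphi_t^{(u_2,u_3,\dots)}(u_1)$ denotes the value at time $t$ of the solution of the scalar ODE $$\frac{dw}{dt}=-2\beta_1w^2-\Big(\sum_{n\ge2}\beta_nu_n\Big)w+\Big(\sum_{n\ge2}\alpha_nu_n+\alpha_2u_2\Big),\qquad w(0)=u_1,$$ with $u_n$, $n\ge2$, held fixed. Second sub-dynamics: for fixed $u_1$, $\chi_t^{u_1}(u_2,u_3,\dots)$ denotes the value at time $t$ of the (classical, in $\mathcal{H}$) solution $(u_n(t))_{n\ge2}$ of the linear system $$\frac{du_n}{dt}=\beta_{n-1}u_1u_{n-1}-(\beta_nu_1+\alpha_n)u_n+\alpha_{n+1}u_{n+1},\quad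 n\ge2,$$ with $u_1$ constant in time, starting from $(u_2,u_3,\dots)$. For $\Delta t>0$, the map $u^{k+1}=S_{\Delta t}(u^k)$ is defined by: (1) $u_1^{k+1}=\varphi_{\Delta t}^{(u_2^k,u_3^k,\dots)}(u_1^k)$; (2) $(u_2^{k+1},u_3^{k+1},\dots)=\chi_{\Delta t}^{u_1^{k+1}}(u_2^k,u_3^k,\dots)$. *)

(* Defs.v *)
From Stdlib Require Import Reals Lra Lia FunctionalExtensionality ProofIrrelevance.
From Coquelicot Require Import Coquelicot.
Open Scope R_scope.

(* Square-summable real sequences indexed by n >= 1.  Sequences are functions on [nat],
   so the unused index 0 carries the value 0: [x n] is the n-th coordinate for n >= 1 and
   a series over [nat] is a sum over n >= 1. *)
Record l2 := mk_l2 {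
  coord :> nat -> R;
  coord_0 : coord 0%nat = 0;
  coord_sq : ex_series (fun n => coord n ^ 2) }.

Definition l2_norm (x : l2) : R := sqrt (Series (fun n => x n ^ 2)).

Lemma l2_ext (x y : l2) : (forall n, x n = y n) -> x = y.
Proof.
  destruct x as [x x0 xs], y as [y y0 ys]; simpl; intros H.
  assert (E : x = y) by (apply functional_extensionality; exact H).
  subst y; f_equal; apply proof_irrelevance.
Qed.

Lemma ex_series_ext_R (a b : nat -> R) :
  (forall n, a n = b n) -> ex_series a -> ex_series b.
Proof. exact (ex_series_ext (V := R_NormedModule) a b). Qed.

Lemma ex_series_lin_sq (a b : R) (x y : nat -> R) :
  ex_series (fun n => x n ^ 2) -> ex_series (fun n => y n ^ 2) ->
  ex_series (fun n => (a * x n + b * y n) ^ 2).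
Proof.
  intros Hx Hy.
  apply (@ex_series_le R_AbsRing R_CompleteNormedModule) with
    (b := fun n => 2 * a ^ 2 * x n ^ 2 + 2 * b ^ 2 * y n ^ 2).
  - intros n; unfold norm; simpl; unfold abs; simpl.
    rewrite Rabs_pos_eq by apply (pow2_ge_0 (a * x n + b * y n)).
    pose proof (pow2_ge_0 (a * x n - b * y n)); simpl in *; lra.
  - apply (ex_series_plus (V := R_NormedModule)).
    + apply (ex_series_scal (V := R_NormedModule)); exact Hx.
    + apply (ex_series_scal (V := R_NormedModule)); exact Hy.
Qed.

Lemma is_series_0 : is_series (fun _ : nat => 0) 0.
Proof.
  apply filterlim_ext with (fun _ : nat => 0).
  - intros n; rewrite sum_n_const; ring.
  - apply filterlim_const.
Qed.

Lemma Series_nonneg (a : nat -> R) :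
  (forall n, 0 <= a n) -> ex_series a -> 0 <= Series a.
Proof.
  intros Ha He.
  rewrite <- (is_series_unique (fun _ => 0) 0 is_series_0).
  apply Series_le; [intros n; split; [lra | apply Ha] | exact He].
Qed.

Definition l2_zero : l2.
Proof.
  refine (mk_l2 (fun _ => 0) eq_refl _).
  apply ex_series_ext_R with (fun _ : nat => 0).
  - intros n; ring.
  - exists 0; exact is_series_0.
Defined.

Definition l2_plus (x y : l2) : l2.
Proof.
  refine (mk_l2 (fun n => x n + y n) _ _).
  - rewrite !coord_0; ring.
  - apply ex_series_ext_R with (fun n => (1 * x n + 1 * y n) ^ 2).
    + intros n; ring.
    + apply ex_series_lin_sq; apply coord_sq.
Defined.

Definition l2_scal (k : R) (x : l2) : l2.
Proof.
  refine (mk_l2 (fun n => k * x n) _ _).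
  - rewrite coord_0; ring.
  - apply ex_series_ext_R with (fun n => (k * x n + 0 * x n) ^ 2).
    + intros n; ring.
    + apply ex_series_lin_sq; apply coord_sq.
Defined.

Definition l2_opp (x : l2) : l2 := l2_scal (-1) x.

Definition l2_AbelianMonoid_mixin : AbelianMonoid.mixin_of l2.
Proof.
  apply (AbelianMonoid.Mixin l2 l2_plus l2_zero);
    intros; apply l2_ext; intros n; simpl; ring.
Defined.

Canonical l2_AbelianMonoid := AbelianMonoid.Pack l2 l2_AbelianMonoid_mixin l2.

Definition l2_AbelianGroup_mixin : AbelianGroup.mixin_of l2_AbelianMonoid.
Proof.
  apply (AbelianGroup.Mixin l2_AbelianMonoid l2_opp).
  intros x; apply l2_ext; intros n; simpl; ring.
Defined.

Canonical l2_AbelianGroup :=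
  AbelianGroup.Pack l2 (AbelianGroup.Class l2 l2_AbelianMonoid_mixin l2_AbelianGroup_mixin) l2.

Definition l2_ModuleSpace_mixin : ModuleSpace.mixin_of R_Ring l2_AbelianGroup.
Proof.
  apply (ModuleSpace.Mixin R_Ring l2_AbelianGroup l2_scal);
    intros; apply l2_ext; intros n; simpl;
    unfold mult, plus, one; simpl; ring.
Defined.

Canonical l2_ModuleSpace :=
  ModuleSpace.Pack R_Ring l2
    (ModuleSpace.Class R_Ring l2 (AbelianGroup.class l2_AbelianGroup) l2_ModuleSpace_mixin) l2.

Lemma l2_norm_ge_0 (x : l2) : 0 <= l2_norm x.
Proof. apply sqrt_pos. Qed.

Lemma l2_norm_sq (x : l2) : l2_norm x ^ 2 = Series (fun n => x n ^ 2).
Proof.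
  apply pow2_sqrt, Series_nonneg; [intros n; apply pow2_ge_0 | apply coord_sq].
Qed.

Lemma l2_coord_le_norm (x : l2) (n : nat) : Rabs (x n) <= l2_norm x.
Proof.
  rewrite <- (Rabs_pos_eq (l2_norm x)) by apply l2_norm_ge_0.
  apply Rsqr_le_abs_0; rewrite !Rsqr_pow2, l2_norm_sq.
  rewrite (Series_incr_n _ (S n)) by (lia || apply coord_sq); simpl pred.
  apply Rle_trans with (sum_f_R0 (fun k => x k ^ 2) n).
  - destruct n as [|n]; simpl sum_f_R0; [lra|].
    assert (0 <= sum_f_R0 (fun k => x k ^ 2) n)
      by (apply cond_pos_sum; intros; apply pow2_ge_0).
    simpl in *; lra.
  - assert (0 <= Series (fun k => x (S n + k)%nat ^ 2)); [|lra].
    apply Series_nonneg; [intros; apply pow2_ge_0|].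
    apply (proj1 (ex_series_incr_n (fun k => x k ^ 2) (S n))), coord_sq.
Qed.

Lemma l2_norm_eq_0 (x : l2) : l2_norm x = 0 -> x = l2_zero.
Proof.
  intros H; apply l2_ext; intros n; simpl.
  pose proof (l2_coord_le_norm x n) as Hn; rewrite H in Hn.
  apply Rabs_eq_0; pose proof (Rabs_pos (x n)); lra.
Qed.

Lemma l2_norm_scal (k : R) (x : l2) : l2_norm (l2_scal k x) = Rabs k * l2_norm x.
Proof.
  unfold l2_norm; simpl coord.
  rewrite (Series_ext _ (fun n => k ^ 2 * x n ^ 2)) by (intros; ring).
  rewrite Series_scal_l, sqrt_mult_alt by apply pow2_ge_0.
  f_equal; rewrite <- Rsqr_pow2; apply sqrt_Rsqr_abs.
Qed.

Lemma l2_norm_lin_sq (a b : R) (x y : l2) :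
  ex_series (fun n => x n * y n) /\
  l2_norm (l2_plus (l2_scal a x) (l2_scal b y)) ^ 2 =
    a ^ 2 * l2_norm x ^ 2 + 2 * a * b * Series (fun n => x n * y n) + b ^ 2 * l2_norm y ^ 2.
Proof.
  pose proof (coord_sq x) as Hx; pose proof (coord_sq y) as Hy.
  assert (Hxy : ex_series (fun n => x n * y n)).
  { apply ex_series_ext_R with
      (fun n => / 2 * (1 * x n + 1 * y n) ^ 2 - / 2 * (x n ^ 2 + y n ^ 2)).
    - intros n; simpl; field.
    - apply (ex_series_minus (V := R_NormedModule));
        apply (ex_series_scal (V := R_NormedModule)).
      + apply ex_series_lin_sq; assumption.
      + apply (ex_series_plus (V := R_NormedModule)); assumption. }
  split; [exact Hxy|].
  rewrite !l2_norm_sq; simpl coord.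
  rewrite (Series_ext _ (fun n => (a ^ 2 * x n ^ 2 + 2 * a * b * (x n * y n))
                                  + b ^ 2 * y n ^ 2)) by (intros; ring).
  rewrite !Series_plus, !Series_scal_l; trivial;
    repeat first
      [ apply (ex_series_plus (V := R_NormedModule))
      | apply (ex_series_scal (V := R_NormedModule)) ]; assumption.
Qed.

Lemma l2_norm_triangle (x y : l2) : l2_norm (l2_plus x y) <= l2_norm x + l2_norm y.
Proof.
  pose proof (l2_norm_ge_0 x) as Hx; pose proof (l2_norm_ge_0 y) as Hy.
  destruct (Req_dec (l2_norm x) 0) as [Ex|Ex].
  { rewrite Ex; apply l2_norm_eq_0 in Ex; subst x.
    replace (l2_plus l2_zero y) with y by (apply l2_ext; intros; simpl; ring); lra. }
  destruct (Req_dec (l2_norm y) 0) as [Ey|Ey].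
  { rewrite Ey; apply l2_norm_eq_0 in Ey; subst y.
    replace (l2_plus x l2_zero) with x by (apply l2_ext; intros; simpl; ring); lra. }
  destruct (l2_norm_lin_sq 1 1 x y) as [_ E1].
  destruct (l2_norm_lin_sq (l2_norm y) (- l2_norm x) x y) as [_ E2].
  replace (l2_plus (l2_scal 1 x) (l2_scal 1 y)) with (l2_plus x y) in E1
    by (apply l2_ext; intros; simpl; ring).
  set (p := Series (fun n => x n * y n)) in *.
  set (z := l2_plus _ _) in E2.
  pose proof (pow2_ge_0 (l2_norm z)) as Hz; rewrite E2 in Hz.
  assert (Hp : p <= l2_norm x * l2_norm y).
  { assert (0 < l2_norm x * l2_norm y) by (apply Rmult_lt_0_compat; lra).
    apply Rmult_le_reg_l with (l2_norm x * l2_norm y); [assumption | nra]. }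
  apply Rsqr_incr_0_var; [rewrite !Rsqr_pow2, E1; nra | lra].
Qed.

Definition l2_ball (x : l2) (e : R) (y : l2) : Prop := l2_norm (minus y x) < e.

Lemma l2_minus_coord (x y : l2) (n : nat) : minus x y n = x n - y n.
Proof. unfold minus, plus, opp; simpl; ring. Qed.

Definition l2_UniformSpace_mixin : UniformSpace.mixin_of l2.
Proof.
  apply (UniformSpace.Mixin l2 l2_zero l2_ball); unfold l2_ball.
  - intros x e.
    replace (minus x x) with (l2_scal 0 x)
      by (apply l2_ext; intros; rewrite l2_minus_coord; simpl; ring).
    rewrite l2_norm_scal, Rabs_R0, Rmult_0_l; apply cond_pos.
  - intros x y e H.
    replace (minus x y) with (l2_scal (-1) (minus y x))
      by (apply l2_ext; intros; unfold minus, plus, opp; simpl; ring).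
    rewrite l2_norm_scal, Rabs_left by lra; lra.
  - intros x y z e1 e2 H1 H2.
    replace (minus z x) with (l2_plus (minus y x) (minus z y))
      by (apply l2_ext; intros; unfold minus, plus, opp; simpl; ring).
    eapply Rle_lt_trans; [apply l2_norm_triangle | lra].
Defined.

Canonical l2_UniformSpace := UniformSpace.Pack l2 l2_UniformSpace_mixin l2.

Canonical l2_NormedModuleAux :=
  NormedModuleAux.Pack R_AbsRing l2
    (NormedModuleAux.Class R_AbsRing l2 (ModuleSpace.class R_Ring l2_ModuleSpace)
       l2_UniformSpace_mixin) l2.

Definition l2_NormedModule_mixin : NormedModule.mixin_of R_AbsRing l2_NormedModuleAux.
Proof.
  apply (NormedModule.Mixin R_AbsRing l2_NormedModuleAux l2_norm 1).
  - exact l2_norm_triangle.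
  - intros k x; right; apply l2_norm_scal.
  - intros x y e H; exact H.
  - intros x y e H; rewrite Rmult_1_l; exact H.
  - exact l2_norm_eq_0.
Defined.

Canonical l2_NormedModule :=
  NormedModule.Pack R_AbsRing l2
    (NormedModule.Class R_AbsRing l2 (NormedModuleAux.class R_AbsRing l2_NormedModuleAux)
       l2_NormedModule_mixin) l2.

Definition inQ (x : l2) : Prop :=
  (forall n, (1 <= n)%nat -> 0 <= x n) /\ ex_series (fun n => INR n * x n).

(* Derivative at [t] of a curve defined on [D]; on [D = Rle 0] it is one-sided at [t = 0]. *)
Definition is_derive_within {V : NormedModule R_AbsRing}
    (D : R -> Prop) (f : R -> V) (t : R) (l : V) : Prop :=
  filterdiff f (within D (locally t)) (fun h : R => scal h l).

Definition is_C1_Rplus {V : NormedModule R_AbsRing} (f f' : R -> V) : Prop :=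
  (forall t, 0 <= t -> is_derive_within (Rle 0) f t (f' t)) /\
  continuous_on (Rle 0) f'.

Definition sum_from_2 (a : nat -> R) : R := Series (fun n => a (n + 2)%nat).

Definition is_BD_solution (alpha beta : nat -> R) (u0 : l2) (u : R -> l2) : Prop :=
  u 0 = u0 /\
  (forall t, 0 <= t -> inQ (u t)) /\
  continuous_on (Rle 0) u /\
  exists u' : R -> l2,
    is_C1_Rplus u u' /\
    forall t, 0 <= t ->
      u' t 1%nat =
        - 2 * beta 1%nat * u t 1%nat ^ 2
        - sum_from_2 (fun n => beta n * u t n * u t 1%nat)
        + sum_from_2 (fun n => alpha n * u t n)
        + alpha 2%nat * u t 2%nat /\
      forall n, (2 <= n)%nat ->
        u' t n =
          beta (n - 1)%nat * u t (n - 1)%nat * u t 1%nat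
          - (beta n * u t 1%nat + alpha n) * u t n
          + alpha (n + 1)%nat * u t (n + 1)%nat.

Definition is_phi_solution (alpha beta : nat -> R) (x : l2) (w : R -> R) : Prop :=
  w 0 = x 1%nat /\
  forall t, 0 <= t ->
    is_derive_within (Rle 0) w t
      (- 2 * beta 1%nat * w t ^ 2
       - sum_from_2 (fun n => beta n * x n) * w t
       + (sum_from_2 (fun n => alpha n * x n) + alpha 2%nat * x 2%nat)).

(* The unknown (v_2, v_3, ...) is stored together with the frozen first coordinate
   v_1 = c, which is also the value entering the equation for n = 2. *)
Definition is_chi_solution (alpha beta : nat -> R) (c : R) (x : l2) (v : R -> l2) : Prop :=
  (forall n, (2 <= n)%nat -> v 0 n = x n) /\
  (forall t, 0 <= t -> v t 1%nat = c) /\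
  exists v' : R -> l2,
    is_C1_Rplus v v' /\
    forall t, 0 <= t -> forall n, (2 <= n)%nat ->
      v' t n =
        beta (n - 1)%nat * c * v t (n - 1)%nat
        - (beta n * c + alpha n) * v t n
        + alpha (n + 1)%nat * v t (n + 1)%nat.

(* Graph of the splitting map: y = S_dt(x). *)
Definition splitting_step (alpha beta : nat -> R) (dt : R) (x y : l2) : Prop :=
  exists (w : R -> R) (v : R -> l2),
    is_phi_solution alpha beta x w /\
    is_chi_solution alpha beta (w dt) x v /\
    y = v dt.

Definition splitting_iterates (alpha beta : nat -> R) (dt : R) (u0 : l2) (U : nat -> l2) : Prop :=
  U 0%nat = u0 /\ forall k, splitting_step alpha beta dt (U k) (U (S k)).

(* Main.v *)
Require Import Defs.
From Stdlib Require Import Reals Lra Lia Psatz.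
From Coquelicot Require Import Coquelicot.
Open Scope R_scope.

(** The splitting scheme has local errors of order [dt ^ 2], so the point is stability.  The
    l2 norm is not suited to it, since the sums [beta_n u_n] and [alpha_n u_n] in the monomer
    equation need not be continuous for that norm.  The error [e = u - U] is measured instead by
    [|e_1|] plus the l1 norm of the tails [z_n = e_n + e_(n+1) + ...], [n >= 2], which dominates
    half of the l2 norm ([l2_norm_le_tail_err]).

    For this distance everything closes.  Since [e_n = z_n - z_(n+1)] and the rates have bounded
    increments, an Abel summation bounds [sum beta_n e_n] by [sum |z_n|]
    ([rate_diff_le_tails]).  The time derivative of [z_n] is a difference of fluxes from size
    [n - 1] to size [n], that is a discrete transport of [z] up and down in [n] with the rates
    [beta] and [alpha], plus sources proportional to the monomer error.  Transport is
    dissipative in l1 up to the increments of the rates ([growth_transport],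
    [shrink_transport]).  Freezing the clusters, then the monomers, during a step costs a source
    of order [dt], because rate sums and monomers vary at bounded speed
    ([rate_psum_drift], [monomer_rhs_bound]).  Gronwall's lemma gives [one_step].

    All infinite sums are truncated: tails are cut at [cutoff N] and only [N] of them are
    summed, so that only finite sums are differentiated.  Given a bound on the first moment, the
    growth of the rates like [sqrt n] makes all truncation errors [O(1 / sqrt N)], and [N] tends
    to infinity at the end.

    The constants depend on bounds on the monomers and on the first moment.  Sequences solving
    the cluster equations and bounded uniformly in time stay non-negative
    ([cluster_curve_nonneg]) and keep a finite first moment ([cluster_curve_moment]), as shown
    with the weights [n / (1 + eta n ^ 2)], which decay at infinity and tend to [n] as [eta] tends
    to 0.  For the numerical solution
    these bounds need a bound on the monomers, which is propagated along the induction on the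
    steps ([splitting_error]): as long as the error is at most 1 the numerical monomers are
    within distance 1 of the exact ones. *)

(** * Finite sums over cluster sizes n >= 2 *)

(** [psum a k] is the sum of the [k] terms [a 2, ..., a (k + 1)]. *)
Fixpoint psum (a : nat -> R) (k : nat) : R :=
  match k with
  | O => 0
  | S j => psum a j + a (S (S j))
  end.

Lemma psum_ext (a b : nat -> R) k :
  (forall i, a (S (S i)) = b (S (S i))) -> psum a k = psum b k.
Proof. intros H; induction k as [|k IH]; simpl; [reflexivity | now rewrite IH, H]. Qed.

Lemma psum_le (a b : nat -> R) k :
  (forall i, (i < k)%nat -> a (S (S i)) <= b (S (S i))) -> psum a k <= psum b k.
Proof.
  induction k as [|k IH]; simpl; intros H; [lra|].
  assert (a (S (S k)) <= b (S (S k))) by (apply H; lia).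
  assert (psum a k <= psum b k) by (apply IH; intros; apply H; lia). lra.
Qed.

Lemma psum_plus (a b : nat -> R) k : psum (fun n => a n + b n) k = psum a k + psum b k.
Proof. induction k as [|k IH]; simpl; [ring | rewrite IH; ring]. Qed.

Lemma psum_scal (c : R) (a : nat -> R) k : psum (fun n => c * a n) k = c * psum a k.
Proof. induction k as [|k IH]; simpl; [ring | rewrite IH; ring]. Qed.

Lemma psum_minus (a b : nat -> R) k : psum (fun n => a n - b n) k = psum a k - psum b k.
Proof. induction k as [|k IH]; simpl; [ring | rewrite IH; ring]. Qed.

Lemma psum_const (c : R) k : psum (fun _ => c) k = INR k * c.
Proof. induction k as [|k IH]; [simpl; ring | simpl psum; rewrite IH, S_INR; ring]. Qed.

Lemma psum_pos (a : nat -> R) k : (forall i, 0 <= a (S (S i))) -> 0 <= psum a k.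
Proof.
  intros H; induction k as [|k IH]; simpl; [lra | specialize (H k); lra].
Qed.

Lemma psum_abs (a : nat -> R) k : Rabs (psum a k) <= psum (fun n => Rabs (a n)) k.
Proof.
  induction k as [|k IH]; simpl; [rewrite Rabs_R0; lra|].
  eapply Rle_trans; [apply Rabs_triang | lra].
Qed.

Lemma psum_mono (a : nat -> R) j k :
  (forall i, 0 <= a (S (S i))) -> (j <= k)%nat -> psum a j <= psum a k.
Proof.
  intros Ha Hjk; induction Hjk as [|k _ IH]; [lra|]; simpl; specialize (Ha k); lra.
Qed.

Lemma psum_term (a : nat -> R) k i :
  (forall i, 0 <= a (S (S i))) -> (i < k)%nat -> a (S (S i)) <= psum a k.
Proof.
  intros Ha Hi; apply Rle_trans with (psum a (S i)); [|apply psum_mono; [exact Ha | lia]].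
  simpl; pose proof (psum_pos a i Ha); lra.
Qed.

Lemma psum_range_le (a b : nat -> R) j k :
  (j <= k)%nat -> (forall i, (j <= i < k)%nat -> Rabs (a (S (S i))) <= b (S (S i))) ->
  Rabs (psum a k - psum a j) <= psum b k - psum b j.
Proof.
  intros Hjk; induction Hjk as [|k Hjk IH]; intros H.
  - rewrite !Rminus_diag, Rabs_R0; lra.
  - simpl. replace (psum a k + a (S (S k)) - psum a j)
      with ((psum a k - psum a j) + a (S (S k))) by ring.
    assert (Rabs (a (S (S k))) <= b (S (S k))) by (apply H; lia).
    assert (Rabs (psum a k - psum a j) <= psum b k - psum b j)
      by (apply IH; intros; apply H; lia).
    eapply Rle_trans; [apply Rabs_triang | lra].
Qed.

(** Abel summation. *)
Lemma psum_abel (th d : nat -> R) k :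
  psum (fun n => th n * (d n - d (S n))) k =
  th 1%nat * d 2%nat + psum (fun n => (th n - th (pred n)) * d n) k
  - th (S k) * d (S (S k)).
Proof. induction k as [|k IH]; simpl; [ring | rewrite IH; simpl; ring]. Qed.

Lemma psum_telescope (d : nat -> R) k :
  psum (fun n => d n - d (S n)) k = d 2%nat - d (S (S k)).
Proof. induction k as [|k IH]; simpl; [ring | rewrite IH; ring]. Qed.

Lemma psum_is_derive (f : R -> nat -> R) (df : nat -> R) (s : R) k :
  (forall i, (i < k)%nat ->
     is_derive (fun t => f t (S (S i))) s (df (S (S i)))) ->
  is_derive (fun t => psum (f t) k) s (psum df k).
Proof.
  induction k as [|k IH]; simpl; intros H.
  - apply (is_derive_const (V := R_NormedModule)).
  - apply (is_derive_plus (V := R_NormedModule)); [apply IH; intros | ]; apply H; lia.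
Qed.

Lemma psum_continuous (f : R -> nat -> R) (s : R) k :
  (forall i, continuous (fun t => f t (S (S i))) s) ->
  continuous (fun t => psum (f t) k) s.
Proof.
  induction k as [|k IH]; simpl; intros H.
  - apply continuous_const.
  - apply (continuous_plus (V := R_NormedModule)); [apply IH; intros |]; apply H.
Qed.

Lemma sum_n_psum (a : nat -> R) k : sum_n (fun n => a (n + 2)%nat) k = psum a (S k).
Proof.
  induction k as [|k IH].
  - rewrite sum_O; simpl; ring.
  - rewrite sum_Sn, IH; unfold plus; simpl. replace (k + 2)%nat with (S (S k)) by lia.
    reflexivity.
Qed.

Lemma ex_series_is_lim_psum (a : nat -> R) :
  ex_series (fun n => a (n + 2)%nat) -> is_lim_seq (psum a) (sum_from_2 a).
Proof.
  intros H; apply is_lim_seq_incr_1.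
  apply is_lim_seq_ext with (fun k => sum_n (fun n => a (n + 2)%nat) k).
  - intros k; apply sum_n_psum.
  - exact (Series_correct _ H).
Qed.

Lemma psum_bounded_ex_series (a : nat -> R) (D : R) :
  (forall i, 0 <= a (S (S i))) -> (forall k, psum a k <= D) ->
  ex_series (fun n => a (n + 2)%nat).
Proof.
  intros Ha HD; destruct (ex_finite_lim_seq_incr (fun k => psum a (S k)) D) as [l Hl].
  - intros k; apply psum_mono; [exact Ha | lia].
  - intros k; apply HD.
  - assert (Hl' : is_lim_seq (fun k => sum_n (fun n => a (n + 2)%nat) k) l).
    { apply is_lim_seq_ext with (fun k => psum a (S k)); [|exact Hl].
      intros k; symmetry; apply sum_n_psum. }
    exists l; exact Hl'.
Qed.

(** A series of non-negative terms whose partial sums stay within [D] of [psum a N]. *)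
Lemma sum_from_2_tail (a : nat -> R) (N : nat) (D : R) :
  (forall i, 0 <= a (S (S i))) ->
  (forall k, (N <= k)%nat -> psum a k - psum a N <= D) ->
  0 <= sum_from_2 a - psum a N <= D.
Proof.
  intros Ha HD.
  assert (Hb : forall k, psum a k <= psum a N + D).
  { intros k; destruct (Nat.le_ge_cases N k) as [H|H].
    - specialize (HD k H); lra.
    - pose proof (psum_mono a k N Ha H); specialize (HD N (le_n N)); lra. }
  pose proof (psum_bounded_ex_series a _ Ha Hb) as Hex.
  pose proof (ex_series_is_lim_psum a Hex) as Hl.
  split.
  - assert (Rbar_le (psum a N) (sum_from_2 a)); [|simpl in *; lra].
    apply (is_lim_seq_le (fun _ => psum a N) (fun k => psum a (k + N)%nat)).
    + intros k; apply psum_mono; [exact Ha | lia].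
    + apply is_lim_seq_const.
    + apply (is_lim_seq_incr_n (psum a) N); exact Hl.
  - assert (Rbar_le (sum_from_2 a) (psum a N + D)); [|simpl in *; lra].
    apply (is_lim_seq_le (psum a) (fun _ => psum a N + D)); [exact Hb | exact Hl |].
    apply is_lim_seq_const.
Qed.

(** * A differential inequality *)

Lemma exp_mono x y : x <= y -> exp x <= exp y.
Proof.
  intros H; destruct (Rle_lt_or_eq_dec _ _ H) as [L|L];
    [left; apply exp_increasing; exact L | rewrite L; lra].
Qed.

Lemma nonincreasing_of_derive (f : R -> R) (T : R) :
  0 <= T ->
  (forall s, 0 <= s <= T -> continuous f s) ->
  (forall s, 0 < s < T -> exists d : R, is_derive f s d /\ d <= 0) ->
  f T <= f 0.
Proof.
  intros HT Hc Hd.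
  set (df := fun s => if Rlt_dec 0 s then if Rlt_dec s T then Derive f s else 0 else 0).
  destruct (MVT_gen f 0 T df) as [c [_ E]].
  - rewrite Rmin_left, Rmax_right by lra; intros s Hs; unfold df.
    destruct (Rlt_dec 0 s); [|lra]; destruct (Rlt_dec s T); [|lra].
    destruct (Hd s Hs) as [d [D _]]; rewrite (is_derive_unique f s d D); exact D.
  - rewrite Rmin_left, Rmax_right by lra; intros s Hs.
    apply continuity_pt_filterlim; exact (Hc s Hs).
  - assert (df c <= 0).
    { unfold df; destruct (Rlt_dec 0 c); [|lra]; destruct (Rlt_dec c T); [|lra].
      destruct (Hd c (conj r r0)) as [d [D Hle]].
      rewrite (is_derive_unique f c d D); exact Hle. }
    nra.
Qed.

Lemma gronwall (f : R -> R) (A D T : R) :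
  0 <= A -> 0 <= D -> 0 <= T ->
  (forall s, 0 <= s <= T -> continuous f s) ->
  (forall s, 0 < s < T -> exists d : R, is_derive f s d /\ d <= A * f s + D) ->
  f T <= exp (A * T) * (f 0 + D * T).
Proof.
  intros HA HD HT Hc Hd.
  set (g := fun s => exp (- (A * s)) * f s - D * s).
  assert (Hexp : forall s, is_derive (fun s => exp (- (A * s))) s (- A * exp (- (A * s)))).
  { intros s; auto_derive; [trivial | ring]. }
  assert (Hg : g T <= g 0).
  { apply nonincreasing_of_derive; [exact HT | |].
    - intros s Hs; unfold g.
      apply (continuous_minus (V := R_NormedModule)).
      + apply (continuous_mult (K := R_AbsRing)); [|apply Hc, Hs].
        apply (ex_derive_continuous (K := R_AbsRing) (V := R_NormedModule)); eexists; apply Hexp.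
      + apply (continuous_mult (K := R_AbsRing));
          [apply continuous_const | apply continuous_id].
    - intros s Hs; destruct (Hd s Hs) as [d [Df Hle]].
      exists ((- A * exp (- (A * s))) * f s + exp (- (A * s)) * d - D); split.
      + apply (is_derive_minus (V := R_NormedModule)).
        * apply (is_derive_mult (K := R_AbsRing) (fun s => exp (- (A * s))) f s);
            [apply Hexp | exact Df | exact Rmult_comm].
        * auto_derive; [trivial | ring].
      + assert (E : 0 < exp (- (A * s)) <= 1).
        { split; [apply exp_pos|]; rewrite <- exp_0; apply exp_mono.
          assert (0 <= A * s) by (apply Rmult_le_pos; lra); lra. }
        assert (exp (- (A * s)) * d <= exp (- (A * s)) * (A * f s + D))
          by (apply Rmult_le_compat_l; lra).
        nra. }
  unfold g in Hg; rewrite !Rmult_0_r, Ropp_0, exp_0 in Hg.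
  assert (E : exp (A * T) * exp (- (A * T)) = 1).
  { rewrite <- exp_plus, Rplus_opp_r; apply exp_0. }
  replace (f T) with (exp (A * T) * (exp (- (A * T)) * f T))
    by (rewrite <- Rmult_assoc, E; ring).
  apply Rmult_le_compat_l; [left; apply exp_pos | lra].
Qed.

(** * Rate sequences *)

(** Rates growing at most like the square root, with bounded increments. *)
Record admissible (K B : R) (th : nat -> R) : Prop := {
  adm_nonneg : forall n, (1 <= n)%nat -> 0 <= th n;
  adm_growth : forall n, (1 <= n)%nat -> th n <= K * sqrt (INR n);
  adm_incr : forall n, (1 <= n)%nat -> Rabs (th (S n) - th n) <= B }.

Lemma INR_ge_1 n : (1 <= n)%nat -> 1 <= INR n.
Proof. intros H; apply (le_INR 1); exact H. Qed.

Lemma sqrt_INR_facts n : (1 <= n)%nat ->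
  1 <= sqrt (INR n) <= INR n /\ sqrt (INR n) * sqrt (INR n) = INR n.
Proof.
  intros H; pose proof (INR_ge_1 n H) as H1.
  assert (E : sqrt (INR n) * sqrt (INR n) = INR n) by (apply sqrt_sqrt; lra).
  assert (1 <= sqrt (INR n)) by (rewrite <- sqrt_1; apply sqrt_le_1_alt; exact H1).
  repeat split; nra.
Qed.

Lemma sqrt_INR_S n : (1 <= n)%nat -> sqrt (INR (S n)) <= 2 * sqrt (INR n).
Proof.
  intros H; pose proof (INR_ge_1 n H) as H1.
  replace 2 with (sqrt 4) by (replace 4 with (2 * 2) by ring; apply sqrt_square; lra).
  rewrite <- sqrt_mult by lra; apply sqrt_le_1_alt; rewrite S_INR; lra.
Qed.

Lemma div_sqrt_nonneg x k : 0 <= x -> 0 <= x / sqrt (INR (S k)).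
Proof.
  intros H; apply Rmult_le_pos; [exact H|]; left; apply Rinv_0_lt_compat.
  destruct (sqrt_INR_facts (S k) ltac:(lia)); lra.
Qed.

Lemma adm_K_nonneg K B th : admissible K B th -> 0 <= K.
Proof.
  intros [H0 H1 _]; specialize (H0 1%nat (le_n _)); specialize (H1 1%nat (le_n _)).
  simpl in H1; rewrite sqrt_1 in H1; lra.
Qed.

Lemma adm_B_nonneg K B th : admissible K B th -> 0 <= B.
Proof.
  intros [_ _ H]; eapply Rle_trans; [apply Rabs_pos | apply (H 1%nat (le_n _))].
Qed.

Lemma adm_linear K B th n : admissible K B th -> (1 <= n)%nat -> th n <= K * INR n.
Proof.
  intros H Hn; pose proof (adm_K_nonneg _ _ _ H).
  pose proof (adm_growth _ _ _ H n Hn); pose proof (sqrt_INR_facts n Hn); nra.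
Qed.

Lemma adm_first K B th : admissible K B th -> th 1%nat <= K.
Proof. intros H; pose proof (adm_linear _ _ _ 1 H (le_n _)) as E; simpl in E; lra. Qed.

(** Net flux from clusters of size [n] to clusters of size [n + 1]. *)
Definition flux (alpha beta : nat -> R) (y : nat -> R) (n : nat) : R :=
  beta n * y 1%nat * y n - alpha (S n) * y (S n).

(** Curves of sequences, continuous coordinate by coordinate, whose coordinates [n >= 2]
    obey the Becker-Doring equations on the open interval (0, T) while the coordinate 1 is
    arbitrary: both the full system and the frozen-monomer one are of this form. *)
Record cluster_curve (alpha beta : nat -> R) (T : R) (y : R -> nat -> R) : Prop := {
  cc_cont : forall n s, continuous (fun t => y t n) s;
  cc_deriv : forall n s, 0 < s < T ->
    is_derive (fun t => y t (S (S n))) s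
      (flux alpha beta (y s) (S n) - flux alpha beta (y s) (S (S n))) }.

(** Weights increasing to [n] as [eta] decreases to 0, but decaying like [1 / (eta n)] for
    fixed [eta], so that the boundary flux of a truncated sum vanishes in the limit. *)
Definition wgt (eta : R) (n : nat) : R := INR n / (1 + eta * INR n ^ 2).

Lemma wgt_den eta n : 0 < eta -> 0 < 1 + eta * INR n ^ 2.
Proof. intros H; pose proof (pow2_ge_0 (INR n)); nra. Qed.

Lemma wgt_pos eta n : 0 < eta -> 0 <= wgt eta n.
Proof.
  intros H; unfold wgt, Rdiv; apply Rmult_le_pos; [apply pos_INR|].
  left; apply Rinv_0_lt_compat, wgt_den, H.
Qed.

Lemma wgt_le_id eta n : 0 < eta -> wgt eta n <= INR n.
Proof.
  intros H; pose proof (wgt_den eta n H); pose proof (pos_INR n).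
  unfold wgt; apply Rle_div_l; [lra|].
  pose proof (pow2_ge_0 (INR n)); assert (0 <= eta * INR n ^ 2) by nra; nra.
Qed.

Lemma wgt_up eta n K th : 0 < eta -> (1 <= n)%nat -> 0 <= th <= K * INR n ->
  (wgt eta (S n) - wgt eta n) * th <= K * wgt eta n.
Proof.
  intros He Hn Hth; pose proof (wgt_den eta n He) as D1; pose proof (wgt_den eta (S n) He) as D2.
  pose proof (INR_ge_1 n Hn).
  set (i := / (1 + eta * INR n ^ 2)).
  assert (Hi : 0 < i) by (apply Rinv_0_lt_compat, D1).
  assert (wgt eta (S n) <= INR (S n) * i).
  { unfold wgt, Rdiv, i; apply Rmult_le_compat_l; [apply pos_INR|].
    apply Rinv_le_contravar; [exact D1|]; rewrite S_INR.
    assert (INR n ^ 2 <= (INR n + 1) ^ 2) by nra; nra. }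
  replace (wgt eta n) with (INR n * i) by reflexivity.
  rewrite S_INR in *. nra.
Qed.

Lemma wgt_down eta n K th : 0 < eta -> (1 <= n)%nat -> 0 <= th <= K * INR (S n) ->
  (wgt eta n - wgt eta (S n)) * th <= 2 * K * wgt eta (S n).
Proof.
  intros He Hn Hth; pose proof (wgt_den eta n He) as D1; pose proof (wgt_den eta (S n) He) as D2.
  pose proof (INR_ge_1 n Hn).
  set (i := / (1 + eta * INR (S n) ^ 2)).
  assert (Hi : 0 < i) by (apply Rinv_0_lt_compat, D2).
  assert (wgt eta n <= (INR n + 3) * i).
  { unfold wgt; apply Rle_div_l; [exact D1|]; unfold i.
    rewrite Rmult_assoc, (Rmult_comm (/ _)), <- Rmult_assoc.
    apply Rle_div_r; [exact D2|]; rewrite S_INR in *.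
    set (x := INR n) in *; assert (0 <= eta * x) by nra. assert (eta * x <= eta * x * x) by nra. nra. }
  replace (wgt eta (S n)) with (INR (S n) * i) by reflexivity.
  rewrite S_INR in *. nra.
Qed.

Lemma wgt_boundary eta n : 0 < eta -> (1 <= n)%nat -> wgt eta n <= / (eta * INR n).
Proof.
  intros He Hn; pose proof (wgt_den eta n He); pose proof (INR_ge_1 n Hn).
  unfold wgt; apply Rle_div_l; [assumption|].
  rewrite Rmult_comm; apply Rle_div_r; [nra|]. nra.
Qed.

(** Discrete integration by parts against [wgt eta]: apart from the source at size 1 and
    the boundary flux at the truncation, the weighted sum of the gains and losses is
    controlled by the weighted sum itself. *)
Lemma weighted_flux_sum K B alpha beta eta c (y : nat -> R) k :
  admissible K B alpha -> admissible K B beta -> 0 < eta -> 0 <= c ->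
  (forall n, (1 <= n)%nat -> 0 <= y n) ->
  psum (fun n => wgt eta n *
          (c * (beta (pred n) * y (pred n) - beta n * y n)
           + (alpha (S n) * y (S n) - alpha n * y n))) k
  <= 2 * c * K * y 1%nat + (c + 2) * K * psum (fun n => wgt eta n * y n) k
     + wgt eta (S k) * alpha (S (S k)) * y (S (S k)).
Proof.
  intros Ha Hb He Hc Hy.
  pose proof (adm_K_nonneg _ _ _ Ha) as HK.
  assert (H1 : psum (fun n => wgt eta n * (beta (pred n) * y (pred n) - beta n * y n)) k
    <= wgt eta 2 * beta 1%nat * y 1%nat + K * psum (fun n => wgt eta n * y n) k
       - wgt eta (S (S k)) * beta (S k) * y (S k)).
  { induction k as [|k IH]; [simpl psum; lra|].
    cbn [psum pred].
    assert (E : (wgt eta (S (S (S k))) - wgt eta (S (S k))) * beta (S (S k))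
                <= K * wgt eta (S (S k))).
    { apply wgt_up; [exact He | lia |]; split;
        [apply (adm_nonneg _ _ _ Hb); lia | apply (adm_linear _ _ _ _ Hb); lia]. }
    assert (0 <= y (S (S k))) by (apply Hy; lia).
    nra. }
  assert (H2 : psum (fun n => wgt eta n * (alpha (S n) * y (S n) - alpha n * y n)) k
    <= 2 * K * psum (fun n => wgt eta n * y n) k
       + wgt eta (S k) * alpha (S (S k)) * y (S (S k))).
  { clear H1; induction k as [|k IH].
    - simpl psum. assert (0 <= wgt eta 1 * alpha 2%nat * y 2%nat); [|lra].
      apply Rmult_le_pos; [apply Rmult_le_pos; [apply wgt_pos, He | apply (adm_nonneg _ _ _ Ha); lia] |].
      apply Hy; lia.
    - cbn [psum].
      assert (E : (wgt eta (S k) - wgt eta (S (S k))) * alpha (S (S k))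
                  <= 2 * K * wgt eta (S (S k))).
      { apply wgt_down; [exact He | lia |]; split;
          [apply (adm_nonneg _ _ _ Ha); lia | apply (adm_linear _ _ _ _ Ha); lia]. }
      assert (0 <= y (S (S k))) by (apply Hy; lia).
      nra. }
  rewrite (psum_ext _ (fun n =>
      c * (wgt eta n * (beta (pred n) * y (pred n) - beta n * y n))
      + wgt eta n * (alpha (S n) * y (S n) - alpha n * y n))) by (intros; ring).
  rewrite psum_plus, psum_scal.
  assert (wgt eta 2 * beta 1%nat * y 1%nat <= 2 * K * y 1%nat).
  { apply Rmult_le_compat_r; [apply Hy; lia|].
    pose proof (adm_first _ _ _ Hb); pose proof (adm_nonneg _ _ _ Hb 1%nat (le_n _)).
    pose proof (wgt_pos eta 2 He); pose proof (wgt_le_id eta 2 He) as W; simpl in W; nra. }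
  assert (0 <= wgt eta (S (S k)) * beta (S k) * y (S k)).
  { apply Rmult_le_pos; [apply Rmult_le_pos; [apply wgt_pos, He | apply (adm_nonneg _ _ _ Hb); lia] |].
    apply Hy; lia. }
  nra.
Qed.

(** The boundary term of [weighted_flux_sum], for bounded sequences. *)
Lemma weighted_boundary K B alpha eta R0 x k :
  admissible K B alpha -> 0 < eta -> 0 <= x <= R0 ->
  wgt eta (S k) * alpha (S (S k)) * x <= 2 * K * R0 / eta / sqrt (INR (S k)).
Proof.
  intros Ha He Hx.
  assert (Hk : (1 <= S k)%nat) by lia.
  destruct (sqrt_INR_facts (S k) Hk) as [F1 F2].
  pose proof (wgt_boundary eta (S k) He Hk) as W; pose proof (wgt_pos eta (S k) He) as W0.
  pose proof (adm_growth _ _ _ Ha (S (S k)) ltac:(lia)) as A1.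
  pose proof (adm_nonneg _ _ _ Ha (S (S k)) ltac:(lia)) as A0.
  pose proof (sqrt_INR_S (S k) Hk) as A2; pose proof (adm_K_nonneg _ _ _ Ha) as HK.
  set (q := sqrt (INR (S k))) in *.
  assert (A3 : alpha (S (S k)) <= 2 * K * q) by nra.
  apply Rle_trans with (/ (eta * INR (S k)) * (2 * K * q) * R0).
  - apply Rmult_le_compat; [apply Rmult_le_pos; assumption | tauto | | tauto].
    apply Rmult_le_compat; assumption.
  - right; rewrite <- F2; field; split; nra.
Qed.

Lemma le_of_le_eps (x y z : R) : (forall e, 0 < e -> x <= y + e * z) -> x <= y.
Proof.
  intros H; apply le_epsilon; intros e He.
  assert (Hz : 0 < 1 + Rabs z) by (pose proof (Rabs_pos z); lra).
  eapply Rle_trans; [apply (H (e / (1 + Rabs z))); apply Rdiv_lt_0_compat; assumption|].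
  apply Rplus_le_compat_l.
  apply Rle_trans with (e / (1 + Rabs z) * (1 + Rabs z)); [|right; field; lra].
  apply Rmult_le_compat_l; [left; apply Rdiv_lt_0_compat; assumption|].
  pose proof (Rle_abs z); lra.
Qed.

Lemma le_of_le_sqrt (x y z : R) (j : nat) :
  (forall k, (j <= k)%nat -> x <= y + z / sqrt (INR (S k))) -> x <= y.
Proof.
  intros H; apply le_of_le_eps with (Rabs z); intros e He.
  destruct (INR_archimed 1 (/ (e * e)) ltac:(lra)) as [m Hm]; rewrite Rmult_1_r in Hm.
  eapply Rle_trans; [apply (H (m + j)%nat); lia|].
  apply Rplus_le_compat_l.
  assert (Hk : (1 <= S (m + j))%nat) by lia.
  destruct (sqrt_INR_facts _ Hk) as [F1 F2].
  assert (Hmk : INR m <= INR (S (m + j))) by (apply le_INR; lia).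
  set (q := sqrt (INR (S (m + j)))) in *.
  assert (Hq : / q <= e).
  { assert (/ e <= q).
    { assert (0 < / e) by (apply Rinv_0_lt_compat; exact He).
      rewrite Rinv_mult in Hm; nra. }
    rewrite <- (Rinv_inv e); apply Rinv_le_contravar; [apply Rinv_0_lt_compat; exact He | assumption]. }
  assert (0 < / q) by (apply Rinv_0_lt_compat; lra).
  pose proof (Rle_abs z); pose proof (Rabs_pos z); unfold Rdiv; nra.
Qed.

(** The squared negative part is continuously differentiable. *)
Lemma is_derive_neg_sq (x : R) : is_derive (fun t => Rmin t 0 ^ 2) x (2 * Rmin x 0).
Proof.
  apply is_derive_Reals; intros e He; exists (mkposreal e He); simpl; intros h Hh0 Hh.
  assert (E : Rabs (Rmin (x + h) 0 * (Rmin (x + h) 0 * 1) - Rmin x 0 * (Rmin x 0 * 1)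
                    - 2 * Rmin x 0 * h) <= h ^ 2).
  { apply Rabs_le; unfold Rmin; destruct (Rle_dec (x + h) 0), (Rle_dec x 0); nra. }
  replace ((Rmin (x + h) 0 * (Rmin (x + h) 0 * 1) - Rmin x 0 * (Rmin x 0 * 1)) / h
           - 2 * Rmin x 0)
    with ((Rmin (x + h) 0 * (Rmin (x + h) 0 * 1) - Rmin x 0 * (Rmin x 0 * 1)
           - 2 * Rmin x 0 * h) / h) by (field; exact Hh0).
  unfold Rdiv; rewrite Rabs_mult, Rabs_inv.
  assert (0 < Rabs h) by (apply Rabs_pos_lt, Hh0).
  apply Rle_lt_trans with (Rabs h); [|exact Hh].
  apply Rle_div_l; [assumption|]. rewrite <- pow2_abs in E. simpl in *; lra.
Qed.

Lemma continuous_neg_sq (f : R -> R) s :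
  continuous f s -> continuous (fun t => Rmin (f t) 0 ^ 2) s.
Proof.
  intros Hf; apply (continuous_comp f (fun t => Rmin t 0 ^ 2)); [exact Hf|].
  apply (ex_derive_continuous (K := R_AbsRing) (V := R_NormedModule)); eexists.
  apply is_derive_neg_sq.
Qed.

(** * Positivity and first moment of cluster curves *)

(** The weighted sum of the squared negative parts satisfies a linear differential inequality,
    with a boundary term that vanishes as the truncation is removed. *)
Lemma cluster_curve_nonneg K B alpha beta T C R0 (y : R -> nat -> R) :
  admissible K B alpha -> admissible K B beta -> cluster_curve alpha beta T y ->
  (forall s, 0 <= s <= T -> 0 <= y s 1%nat <= C) ->
  (forall s n, 0 <= s <= T -> (1 <= n)%nat -> Rabs (y s n) <= R0) ->
  (forall n, (1 <= n)%nat -> 0 <= y 0 n) ->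
  0 <= T -> forall n, (1 <= n)%nat -> 0 <= y T n.
Proof.
  intros Ha Hb [Hcont Hder] Hc HR H0 HT n Hn.
  pose proof (adm_K_nonneg _ _ _ Ha) as HK; pose proof (adm_B_nonneg _ _ _ Ha) as HBn.
  destruct n as [|[|n]]; [lia | apply Hc; lra |].
  set (m := fun s n => Rmin (y s n) 0).
  set (A := (C + 2) * K + (C + 1) * B).
  assert (HC : 0 <= C) by (specialize (Hc 0 ltac:(lra)); lra).
  assert (HA : 0 <= A) by (unfold A; nra).
  assert (HR0 : 0 <= R0).
  { eapply Rle_trans; [apply Rabs_pos | apply (HR 0 1%nat); [lra | lia]]. }
  set (D := fun k => 2 * K * R0 ^ 2 / 1 / sqrt (INR (S k))).
  assert (HD : forall k, 0 <= D k).
  { intros k; apply div_sqrt_nonneg; pose proof (pow2_ge_0 R0).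
    unfold Rdiv; rewrite Rinv_1; nra. }
  assert (Main : forall k, psum (fun n => wgt 1 n * m T n ^ 2) k
                           <= exp (A * T) * (0 + D k * T)).
  { intros k.
    assert (E0 : psum (fun n => wgt 1 n * m 0 n ^ 2) k = 0).
    { transitivity (psum (fun _ => 0) k); [|rewrite psum_const; ring].
      apply psum_ext; intros i; unfold m; rewrite Rmin_right by (apply H0; lia); ring. }
    apply Rle_trans with (exp (A * T) * (psum (fun n => wgt 1 n * m 0 n ^ 2) k + D k * T));
      [|rewrite E0; lra].
    apply (gronwall (fun s => psum (fun n => wgt 1 n * m s n ^ 2) k)); [exact HA | apply HD | exact HT | |].
    - intros s Hs; apply (psum_continuous (fun s n => wgt 1 n * m s n ^ 2)); intros i.
      apply (continuous_mult (K := R_AbsRing)); [apply continuous_const|].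
      apply continuous_neg_sq, Hcont.
    - intros s Hs.
      exists (psum (fun n => wgt 1 n * (2 * m s n *
                (flux alpha beta (y s) (pred n) - flux alpha beta (y s) n))) k); split.
      + apply (psum_is_derive (fun s n => wgt 1 n * m s n ^ 2)); intros i Hi.
        apply (is_derive_ext (fun t => scal (wgt 1 (S (S i))) (m t (S (S i)) ^ 2)));
          [reflexivity|].
        apply (is_derive_scal (fun t => m t (S (S i)) ^ 2)).
        pose proof (is_derive_comp (K := R_AbsRing) (V := R_NormedModule)
                      (fun t => Rmin t 0 ^ 2) (fun t => y t (S (S i))) s _ _
                      (is_derive_neg_sq _) (Hder i s Hs)) as Dc.
        cbn [pred]; rewrite Rmult_comm; exact Dc.
      + set (c := y s 1%nat).
        assert (Hcs : 0 <= c <= C) by (apply Hc; lra).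
        eapply Rle_trans; [apply (psum_le _ (fun n =>
            wgt 1 n * (c * (beta (pred n) * m s (pred n) ^ 2 - beta n * m s n ^ 2)
              + (alpha (S n) * m s (S n) ^ 2 - alpha n * m s n ^ 2))
            + (C + 1) * B * (wgt 1 n * m s n ^ 2)))|].
        * intros i _; cbn [pred]; unfold flux; fold c.
          pose proof (wgt_pos 1 (S (S i)) ltac:(lra)) as W.
          pose proof (adm_nonneg _ _ _ Hb (S i) ltac:(lia)) as b1.
          pose proof (adm_nonneg _ _ _ Ha (S (S (S i))) ltac:(lia)) as a3.
          pose proof (adm_incr _ _ _ Hb (S i) ltac:(lia)) as b2.
          pose proof (adm_incr _ _ _ Ha (S (S i)) ltac:(lia)) as a2.
          apply Rabs_le_between in b2; apply Rabs_le_between in a2.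
          assert (Hm : forall n, m s n <= 0 /\ m s n <= y s n /\ m s n * y s n = m s n ^ 2).
          { intros j; unfold m, Rmin; destruct (Rle_dec (y s j) 0); repeat split; nra. }
          destruct (Hm (S i)) as [m1 [m1' _]]; destruct (Hm (S (S i))) as [m2 [_ m2e]];
            destruct (Hm (S (S (S i)))) as [m3 [m3' _]].
          set (p1 := m s (S i)) in *; set (p2 := m s (S (S i))) in *;
            set (p3 := m s (S (S (S i)))) in *.
          set (y1 := y s (S i)) in *; set (y2 := y s (S (S i))) in *;
            set (y3 := y s (S (S (S i)))) in *.
          set (B1 := beta (S i)) in *; set (B2 := beta (S (S i))) in *;
            set (A2 := alpha (S (S i))) in *; set (A3 := alpha (S (S (S i)))) in *.
          assert (Q1 : 2 * p2 * y1 <= p2 ^ 2 + p1 ^ 2).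
          { pose proof (pow2_ge_0 (p2 - p1)); nra. }
          assert (Q3 : 2 * p2 * y3 <= p2 ^ 2 + p3 ^ 2).
          { pose proof (pow2_ge_0 (p2 - p3)); nra. }
          assert (P2 : 0 <= p2 ^ 2) by apply pow2_ge_0.
          assert (E1 : 2 * p2 * (B1 * y1) - 2 * (B2 * p2 ^ 2)
                       <= B1 * p1 ^ 2 - B2 * p2 ^ 2 + B * p2 ^ 2) by nra.
          assert (E3 : 2 * p2 * (A3 * y3) - 2 * (A2 * p2 ^ 2)
                       <= A3 * p3 ^ 2 - A2 * p2 ^ 2 + B * p2 ^ 2) by nra.
          assert (E : 2 * p2 * (B1 * c * y1 - A2 * y2 - (B2 * c * y2 - A3 * y3))
                  <= c * (B1 * p1 ^ 2 - B2 * p2 ^ 2) + (A3 * p3 ^ 2 - A2 * p2 ^ 2)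
                     + (C + 1) * B * p2 ^ 2).
          { replace (2 * p2 * (B1 * c * y1 - A2 * y2 - (B2 * c * y2 - A3 * y3)))
              with (c * (2 * p2 * (B1 * y1) - 2 * (B2 * (p2 * y2)))
                    + (2 * p2 * (A3 * y3) - 2 * (A2 * (p2 * y2)))) by ring.
            rewrite m2e. assert (c * (B * p2 ^ 2) <= C * (B * p2 ^ 2)).
            { apply Rmult_le_compat_r; [apply Rmult_le_pos; assumption | tauto]. }
            nra. }
          apply (Rmult_le_compat_l _ _ _ W) in E. lra.
        * rewrite psum_plus, psum_scal.
          pose proof (weighted_flux_sum K B alpha beta 1 c (fun n => m s n ^ 2) k
                        Ha Hb Rlt_0_1 (proj1 Hcs) (fun n _ => pow2_ge_0 _)) as F.
          cbv beta in F.
          assert (m1 : m s 1%nat = 0) by (unfold m; rewrite Rmin_right; [reflexivity | apply Hcs]).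
          rewrite m1 in F.
          assert (Hb2 : 0 <= m s (S (S k)) ^ 2 <= R0 ^ 2).
          { split; [apply pow2_ge_0|].
            specialize (HR s (S (S k)) ltac:(lra) ltac:(lia)); apply Rabs_le_between in HR.
            unfold m, Rmin; destruct (Rle_dec (y s (S (S k))) 0); nra. }
          pose proof (weighted_boundary K B alpha 1 (R0 ^ 2) _ k Ha Rlt_0_1 Hb2) as G.
          fold (D k) in G.
          assert (P : 0 <= psum (fun n => wgt 1 n * m s n ^ 2) k).
          { apply psum_pos; intros i; apply Rmult_le_pos; [apply wgt_pos; lra | apply pow2_ge_0]. }
          set (X := psum (fun n => wgt 1 n * m s n ^ 2) k) in *.
          assert ((c + 2) * K * X <= (C + 2) * K * X).
          { apply Rmult_le_compat_r; [exact P|]; apply Rmult_le_compat_r; lra. }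
          unfold A; lra. }
  assert (Hz : wgt 1 (S (S n)) * m T (S (S n)) ^ 2 <= 0).
  { apply (le_of_le_sqrt _ _ (exp (A * T) * (2 * K * R0 ^ 2 * T)) (S n)); intros k Hk.
    eapply Rle_trans; [apply (psum_term (fun n => wgt 1 n * m T n ^ 2) k n); [|lia]|].
    - intros i; apply Rmult_le_pos; [apply wgt_pos; lra | apply pow2_ge_0].
    - eapply Rle_trans; [apply Main|]; right; unfold D; field.
      destruct (sqrt_INR_facts (S k) ltac:(lia)); lra. }
  assert (Hw : 0 < wgt 1 (S (S n))).
  { unfold wgt; apply Rdiv_lt_0_compat; [apply lt_0_INR; lia | apply wgt_den; lra]. }
  assert (H : m T (S (S n)) = 0).
  { pose proof (pow2_ge_0 (m T (S (S n)))).
    assert (m T (S (S n)) ^ 2 = 0) by (destruct (Rle_lt_or_eq_dec 0 _ H); [nra | lra]).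
    apply Rsqr_0_uniq; rewrite Rsqr_pow2; assumption. }
  unfold m, Rmin in H; destruct (Rle_dec (y T (S (S n))) 0); lra.
Qed.

Lemma wgt_limit_moment (y : nat -> R) (Y : R) k :
  (forall n, (1 <= n)%nat -> 0 <= y n) ->
  (forall eta, 0 < eta -> psum (fun n => wgt eta n * y n) k <= Y) ->
  psum (fun n => INR n * y n) k <= Y.
Proof.
  intros Hy H; apply (le_of_le_eps _ _ (psum (fun n => INR n ^ 3 * y n) k)); intros e He.
  apply Rle_trans with (psum (fun n => wgt e n * y n + e * (INR n ^ 3 * y n)) k).
  - apply psum_le; intros i _; set (n := S (S i)).
    rewrite <- Rmult_assoc, <- Rmult_plus_distr_r.
    apply Rmult_le_compat_r; [apply Hy; unfold n; lia|].
    pose proof (wgt_den e n He) as Dn; pose proof (pos_INR n) as Hp.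
    apply Rle_trans with (wgt e n * (1 + e * INR n ^ 2)).
    + unfold wgt; right; field; lra.
    + pose proof (wgt_le_id e n He); pose proof (pow2_ge_0 (INR n)).
      assert (wgt e n * (e * INR n ^ 2) <= INR n * (e * INR n ^ 2)) by
        (apply Rmult_le_compat_r; nra). nra.
  - rewrite psum_plus, psum_scal; specialize (H e He); lra.
Qed.

(** The first moment grows at most exponentially: a size-[n] cluster gains a monomer at
    rate at most [C * beta n = O(n)]. *)
Lemma cluster_curve_moment K B alpha beta T C R0 m0 (y : R -> nat -> R) :
  admissible K B alpha -> admissible K B beta -> cluster_curve alpha beta T y ->
  (forall s, 0 <= s <= T -> 0 <= y s 1%nat <= C) ->
  (forall s n, 0 <= s <= T -> (1 <= n)%nat -> 0 <= y s n <= R0) ->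
  (forall k, psum (fun n => INR n * y 0 n) k <= m0) ->
  0 <= T -> forall k,
  psum (fun n => INR n * y T n) k
    <= exp ((C + 2) * K * T) * (m0 + 2 * C ^ 2 * K * T).
Proof.
  intros Ha Hb [Hcont Hder] Hc HR H0 HT k0.
  pose proof (adm_K_nonneg _ _ _ Ha) as HK.
  assert (HC : 0 <= C) by (specialize (Hc 0 ltac:(lra)); lra).
  assert (HR0 : 0 <= R0) by (specialize (HR 0 1%nat ltac:(lra) (le_n _)); lra).
  apply wgt_limit_moment; [intros n Hn; apply HR; [lra | exact Hn]|].
  intros eta He.
  set (A := (C + 2) * K); assert (HA : 0 <= A) by (unfold A; nra).
  set (D := fun k => 2 * K * R0 / eta / sqrt (INR (S k))).
  assert (HD : forall k, 0 <= D k).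
  { intros k; apply div_sqrt_nonneg, Rmult_le_pos; [nra|].
    left; apply Rinv_0_lt_compat; exact He. }
  assert (HD0 : 0 <= 2 * C ^ 2 * K) by (pose proof (pow2_ge_0 C); nra).
  apply (le_of_le_sqrt _ _ (exp (A * T) * (2 * K * R0 / eta * T)) k0); intros k Hk.
  apply Rle_trans with (psum (fun n => wgt eta n * y T n) k).
  { apply psum_mono; [|exact Hk]; intros i; apply Rmult_le_pos; [apply wgt_pos, He|].
    apply HR; [lra | lia]. }
  apply Rle_trans with (exp (A * T) * (psum (fun n => wgt eta n * y 0 n) k
                                       + (2 * C ^ 2 * K + D k) * T)).
  - apply (gronwall (fun s => psum (fun n => wgt eta n * y s n) k));
      [exact HA | specialize (HD k); lra | exact HT | |].
    + intros s Hs; apply (psum_continuous (fun s n => wgt eta n * y s n)); intros i.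
      apply (continuous_mult (K := R_AbsRing)); [apply continuous_const | apply Hcont].
    + intros s Hs.
      exists (psum (fun n => wgt eta n *
                (flux alpha beta (y s) (pred n) - flux alpha beta (y s) n)) k); split.
      * apply (psum_is_derive (fun s n => wgt eta n * y s n)); intros i Hi.
        apply (is_derive_scal (fun t => y t (S (S i)))), Hder, Hs.
      * set (c := y s 1%nat).
        assert (Hcs : 0 <= c <= C) by (apply Hc; lra).
        rewrite (psum_ext _ (fun n => wgt eta n *
            (c * (beta (pred n) * y s (pred n) - beta n * y s n)
             + (alpha (S n) * y s (S n) - alpha n * y s n))))
          by (intros i; cbn [pred]; unfold flux; fold c; ring).
        pose proof (weighted_flux_sum K B alpha beta eta c (y s) k Ha Hb He (proj1 Hcs)) as F.
        assert (Hys : forall n, (1 <= n)%nat -> 0 <= y s n <= R0) by (intros; apply HR; [lra | assumption]).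
        specialize (F (fun n Hn => proj1 (Hys n Hn))).
        pose proof (weighted_boundary K B alpha eta R0 _ k Ha He (Hys (S (S k)) ltac:(lia))) as G.
        fold (D k) in G; fold c in F.
        assert (P : 0 <= psum (fun n => wgt eta n * y s n) k).
        { apply psum_pos; intros i; apply Rmult_le_pos; [apply wgt_pos, He | apply Hys; lia]. }
        set (X := psum (fun n => wgt eta n * y s n) k) in *.
        assert ((c + 2) * K * X <= A * X).
        { unfold A; apply Rmult_le_compat_r; [exact P|]; apply Rmult_le_compat_r; lra. }
        assert (c * K * c <= C * K * C).
        { replace (c * K * c) with (K * (c * c)) by ring.
          replace (C * K * C) with (K * (C * C)) by ring. apply Rmult_le_compat_l; nra. }
        simpl pow; lra.
  - assert (psum (fun n => wgt eta n * y 0 n) k <= m0).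
    { eapply Rle_trans; [|apply (H0 k)]; apply psum_le; intros i _.
      apply Rmult_le_compat_r; [apply HR; [lra | lia] | apply wgt_le_id, He]. }
    replace (exp (A * T) * (2 * K * R0 / eta * T) / sqrt (INR (S k)))
      with (exp (A * T) * (D k * T)) by (unfold D, Rdiv; ring).
    rewrite <- Rmult_plus_distr_l.
    apply Rmult_le_compat_l; [left; apply exp_pos | lra].
Qed.

(** * A smooth convex approximation of the absolute value *)

(** [sqrt (x ^ 2 + eps ^ 2)], which exceeds the absolute value by at most [eps]. *)
Definition sabs (eps x : R) : R := sqrt (x ^ 2 + eps ^ 2).

(** Its derivative. *)
Definition dsabs (eps x : R) : R := x / sabs eps x.

Lemma sabs_arg eps x : 0 < eps -> 0 < x ^ 2 + eps ^ 2.
Proof.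
  intros Heps; pose proof (pow2_ge_0 x); pose proof (pow_lt eps 2 Heps); lra. Qed.

Lemma sabs_pos eps x : 0 < eps -> 0 < sabs eps x.
Proof.
  intros Heps; apply sqrt_lt_R0, sabs_arg, Heps. Qed.

Lemma sabs_sq eps x : 0 < eps -> sabs eps x * sabs eps x = x ^ 2 + eps ^ 2.
Proof.
  intros Heps; apply sqrt_sqrt; left; apply sabs_arg, Heps. Qed.

Lemma Rabs_le_sabs eps x : Rabs x <= sabs eps x.
Proof.
  unfold sabs; rewrite <- sqrt_Rsqr_abs; apply sqrt_le_1_alt; unfold Rsqr.
  pose proof (pow2_ge_0 eps); simpl in *; lra.
Qed.

Lemma sabs_le eps x : 0 < eps -> sabs eps x <= Rabs x + eps.
Proof.
  intros Heps; pose proof (Rabs_pos x); unfold sabs.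
  rewrite <- (sqrt_square (Rabs x + eps)) by lra; apply sqrt_le_1_alt.
  rewrite <- (pow2_abs x); nra.
Qed.

Lemma dsabs_bound eps x : 0 < eps -> Rabs (dsabs eps x) <= 1.
Proof.
  intros Heps; unfold dsabs, Rdiv; rewrite Rabs_mult, Rabs_inv, (Rabs_pos_eq (sabs eps x))
    by (left; apply sabs_pos, Heps).
  apply Rle_div_l; [apply sabs_pos, Heps|]; rewrite Rmult_1_l; apply Rabs_le_sabs.
Qed.

Lemma dsabs_convex eps x y : 0 < eps -> dsabs eps x * (y - x) <= sabs eps y - sabs eps x.
Proof.
  intros Heps; pose proof (sabs_pos eps x Heps) as Px; pose proof (sabs_pos eps y Heps) as Py.
  pose proof (sabs_sq eps x Heps) as Sx; pose proof (sabs_sq eps y Heps) as Sy.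
  assert (E : x * y + eps ^ 2 <= sabs eps x * sabs eps y).
  { apply Rsqr_incr_0_var; [|nra]. unfold Rsqr.
    replace (sabs eps x * sabs eps y * (sabs eps x * sabs eps y))
      with ((sabs eps x * sabs eps x) * (sabs eps y * sabs eps y)) by ring.
    rewrite Sx, Sy. pose proof (pow2_ge_0 (eps * (x - y))); nra. }
  replace (dsabs eps x * (y - x)) with ((x * y - x ^ 2) / sabs eps x)
    by (unfold dsabs; field; lra).
  apply Rle_div_l; [exact Px|]; nra.
Qed.

Lemma dsabs_sign eps x : 0 < eps -> 0 <= dsabs eps x * x.
Proof.
  intros Heps; unfold dsabs; replace (x / sabs eps x * x) with (x ^ 2 / sabs eps x)
    by (field; apply Rgt_not_eq, sabs_pos, Heps).
  apply Rmult_le_pos; [apply pow2_ge_0 | left; apply Rinv_0_lt_compat, sabs_pos, Heps].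
Qed.

Lemma dsabs_mul_le eps x y : 0 < eps -> dsabs eps x * y <= Rabs y.
Proof.
  intros Heps; eapply Rle_trans; [apply Rle_abs|]; rewrite Rabs_mult.
  pose proof (dsabs_bound eps x Heps); pose proof (Rabs_pos y); nra.
Qed.

Lemma is_derive_sabs eps x : 0 < eps -> is_derive (sabs eps) x (dsabs eps x).
Proof.
  intros Heps; pose proof (sabs_arg eps x Heps) as Ha; pose proof (sabs_pos eps x Heps) as Hp.
  assert (E : is_derive (fun t => t ^ 2 + eps ^ 2) x (2 * x)) by (auto_derive; [trivial | ring]).
  replace (dsabs eps x) with (2 * x / (2 * sqrt (x ^ 2 + eps ^ 2)))
    by (fold (sabs eps x); unfold dsabs; field; lra).
  exact (is_derive_sqrt (fun t => t ^ 2 + eps ^ 2) x (2 * x) E Ha).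
Qed.

Lemma is_derive_sabs_comp eps (f : R -> R) s df :
  0 < eps -> is_derive f s df -> is_derive (fun t => sabs eps (f t)) s (dsabs eps (f s) * df).
Proof.
  intros Heps Hf; rewrite Rmult_comm.
  exact (is_derive_comp (K := R_AbsRing) (V := R_NormedModule)
           (sabs eps) f s _ _ (is_derive_sabs _ _ Heps) Hf).
Qed.

Lemma continuous_sabs_comp eps (f : R -> R) s :
  0 < eps -> continuous f s -> continuous (fun t => sabs eps (f t)) s.
Proof.
  intros Heps Hf; apply (continuous_comp f (sabs eps)); [exact Hf|].
  apply (ex_derive_continuous (K := R_AbsRing) (V := R_NormedModule)); eexists.
  apply is_derive_sabs, Heps.
Qed.

(** * States with bounded first moment *)

(** Non-negative states whose monomers and first moment of clusters [n >= 2] are at most [M]. *)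
Record bounded_state (M : R) (y : nat -> R) : Prop := {
  bs_nonneg : forall n, (1 <= n)%nat -> 0 <= y n;
  bs_first : y 1%nat <= M;
  bs_moment : forall k, psum (fun n => INR n * y n) k <= M }.

Lemma bs_term M y n : bounded_state M y -> (1 <= n)%nat -> INR n * y n <= M.
Proof.
  intros [H0 H1 H2] Hn; destruct n as [|[|n]]; [lia | simpl; lra |].
  eapply Rle_trans; [|apply (H2 (S n))].
  apply (psum_term (fun n => INR n * y n) (S n) n); [|lia].
  intros i; apply Rmult_le_pos; [apply pos_INR | apply H0; lia].
Qed.

Lemma bs_M_nonneg M y : bounded_state M y -> 0 <= M.
Proof. intros [H0 H1 _]; specialize (H0 1%nat (le_n _)); lra. Qed.

Lemma rate_term_bound K B M th y n :
  admissible K B th -> bounded_state M y -> (1 <= n)%nat ->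
  0 <= th n * y n <= K * M / sqrt (INR n).
Proof.
  intros Ht Hy Hn.
  pose proof (adm_nonneg _ _ _ Ht n Hn); pose proof (bs_nonneg _ _ Hy n Hn).
  pose proof (adm_growth _ _ _ Ht n Hn); pose proof (bs_term _ _ n Hy Hn) as Hm.
  pose proof (adm_K_nonneg _ _ _ Ht) as HK.
  destruct (sqrt_INR_facts n Hn) as [F1 F2]; set (q := sqrt (INR n)) in *.
  split; [apply Rmult_le_pos; assumption|]; apply -> Rle_div_r; [|lra].
  apply Rle_trans with (K * q * y n * q).
  { apply Rmult_le_compat_r; [lra|]; apply Rmult_le_compat_r; assumption. }
  replace (K * q * y n * q) with (K * ((q * q) * y n)) by ring; rewrite F2.
  apply Rmult_le_compat_l; assumption.
Qed.

Lemma flux_abs_le K B M alpha beta y n :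
  admissible K B alpha -> admissible K B beta -> bounded_state M y -> (1 <= n)%nat ->
  Rabs (flux alpha beta y n) <= M * (beta n * y n) + alpha (S n) * y (S n).
Proof.
  intros Ha Hb Hy Hn.
  destruct (rate_term_bound K B M beta y n Hb Hy Hn) as [B0 _].
  destruct (rate_term_bound K B M alpha y (S n) Ha Hy ltac:(lia)) as [A0 _].
  pose proof (bs_first _ _ Hy); pose proof (bs_nonneg _ _ Hy 1%nat (le_n _)).
  unfold flux; replace (beta n * y 1%nat * y n) with (y 1%nat * (beta n * y n)) by ring.
  apply Rabs_le; nra.
Qed.

Lemma flux_bound K B M alpha beta y n :
  admissible K B alpha -> admissible K B beta -> bounded_state M y -> (1 <= n)%nat ->
  Rabs (flux alpha beta y n) <= K * M * (M + 1) / sqrt (INR n).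
Proof.
  intros Ha Hb Hy Hn; eapply Rle_trans; [apply (flux_abs_le K B M); assumption|].
  destruct (rate_term_bound K B M beta y n Hb Hy Hn) as [_ B1].
  destruct (rate_term_bound K B M alpha y (S n) Ha Hy ltac:(lia)) as [_ A1].
  pose proof (bs_M_nonneg _ _ Hy) as HM; pose proof (adm_K_nonneg _ _ _ Ha) as HK.
  destruct (sqrt_INR_facts n Hn) as [F1 _].
  assert (K * M / sqrt (INR (S n)) <= K * M / sqrt (INR n)).
  { apply Rmult_le_compat_l; [nra|]; apply Rinv_le_contravar; [lra|].
    apply sqrt_le_1_alt, le_INR; lia. }
  replace (K * M * (M + 1) / sqrt (INR n))
    with (M * (K * M / sqrt (INR n)) + K * M / sqrt (INR n)) by (unfold Rdiv; ring).
  nra.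
Qed.

Lemma psum_shift (a : nat -> R) k :
  psum (fun n => a (pred n)) k + a (S k) = a 1%nat + psum a k.
Proof. induction k as [|k IH]; cbn [psum pred] in *; lra. Qed.

Lemma rate_psum_le K B M th y k :
  admissible K B th -> bounded_state M y -> psum (fun n => th n * y n) k <= K * M.
Proof.
  intros Ht Hy; apply Rle_trans with (psum (fun n => K * (INR n * y n)) k).
  - apply psum_le; intros i _; rewrite <- Rmult_assoc; apply Rmult_le_compat_r.
    + apply (bs_nonneg _ _ Hy); lia.
    + apply (adm_linear _ _ _ _ Ht); lia.
  - rewrite psum_scal; apply Rmult_le_compat_l; [apply (adm_K_nonneg _ _ _ Ht)|].
    apply (bs_moment _ _ Hy).
Qed.

Lemma rate_psum_shift_le K B M th y k :
  admissible K B th -> bounded_state M y ->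
  psum (fun n => th (pred n) * y (pred n)) k <= 2 * K * M.
Proof.
  intros Ht Hy; pose proof (psum_shift (fun n => th n * y n) k) as E; cbv beta in E.
  destruct (rate_term_bound K B M th y (S k) Ht Hy ltac:(lia)) as [A0 _].
  destruct (rate_term_bound K B M th y 1 Ht Hy ltac:(lia)) as [_ A1].
  simpl INR in A1; rewrite sqrt_1, Rdiv_1_r in A1.
  pose proof (rate_psum_le K B M th y k Ht Hy); lra.
Qed.

(** The square-root growth of the rates makes truncated rate sums converge uniformly over
    all states with the same moment bound. *)
Lemma rate_sum_tail K B M th y N :
  admissible K B th -> bounded_state M y ->
  0 <= sum_from_2 (fun n => th n * y n) - psum (fun n => th n * y n) N
    <= K * M / sqrt (INR (S N)).
Proof.
  intros Ht Hy; apply sum_from_2_tail.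
  - intros i; apply (rate_term_bound K B M); try assumption; lia.
  - intros k Hk; set (q := sqrt (INR (S N))).
    assert (Hq : 1 <= q) by (apply (sqrt_INR_facts (S N)); lia).
    pose proof (adm_K_nonneg _ _ _ Ht) as HK.
    assert (Hr : 0 < / q) by (apply Rinv_0_lt_compat; lra).
    apply Rle_trans with (psum (fun n => K / q * (INR n * y n)) k
                          - psum (fun n => K / q * (INR n * y n)) N).
    + eapply Rle_trans; [apply Rle_abs|]; apply psum_range_le; [exact Hk|].
      intros i Hi; destruct (rate_term_bound K B M th y (S (S i)) Ht Hy ltac:(lia)) as [A0 _].
      rewrite Rabs_pos_eq by exact A0.
      pose proof (bs_nonneg _ _ Hy (S (S i)) ltac:(lia)) as Y0.
      pose proof (adm_growth _ _ _ Ht (S (S i)) ltac:(lia)) as G.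
      destruct (sqrt_INR_facts (S (S i)) ltac:(lia)) as [F1 F2].
      assert (Hqi : q <= sqrt (INR (S (S i)))) by (apply sqrt_le_1_alt, le_INR; lia).
      rewrite <- F2; set (qi := sqrt (INR (S (S i)))) in *; set (z := y (S (S i))) in *.
      apply Rle_trans with (K * qi * z); [apply Rmult_le_compat_r; assumption|].
      replace (K / q * (qi * qi * z)) with (K * qi * z * (qi / q)) by (field; lra).
      assert (1 <= qi / q) by (apply Rle_div_r; lra).
      assert (0 <= K * qi * z) by (apply Rmult_le_pos; nra). nra.
    + rewrite !psum_scal, <- Rmult_minus_distr_l.
      pose proof (bs_moment _ _ Hy k).
      assert (0 <= psum (fun n => INR n * y n) N).
      { apply psum_pos; intros i; apply Rmult_le_pos; [apply pos_INR|].
        apply (bs_nonneg _ _ Hy); lia. }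
      replace (K * M / q) with (K / q * M) by (unfold Rdiv; ring).
      apply Rmult_le_compat_l; [apply Rmult_le_pos; lra | lra].
Qed.

Lemma rate_sum_bounds K B M th y :
  admissible K B th -> bounded_state M y ->
  0 <= sum_from_2 (fun n => th n * y n) <= K * M.
Proof.
  intros Ht Hy; pose proof (rate_sum_tail K B M th y 0 Ht Hy) as H.
  simpl INR in H; rewrite sqrt_1, Rdiv_1_r in H; simpl psum in H; lra.
Qed.

(** * Lipschitz bounds along a curve *)

Lemma lipschitz_of_derive (f : R -> R) (D T : R) :
  0 <= D -> 0 <= T ->
  (forall s, 0 <= s <= T -> continuous f s) ->
  (forall s, 0 < s < T -> exists d : R, is_derive f s d /\ Rabs d <= D) ->
  Rabs (f T - f 0) <= D * T.
Proof.
  intros HD HT Hc Hd.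
  assert (H1 : f T <= exp (0 * T) * (f 0 + D * T)).
  { apply gronwall; try lra; [exact Hc|]; intros s Hs; destruct (Hd s Hs) as [d [E L]].
    exists d; split; [exact E|]; apply Rabs_le_between in L; lra. }
  assert (H2 : - f T <= exp (0 * T) * (- f 0 + D * T)).
  { apply (gronwall (fun s => - f s)); try lra.
    - intros s Hs; apply (continuous_opp (V := R_NormedModule)), Hc, Hs.
    - intros s Hs; destruct (Hd s Hs) as [d [E L]].
      exists (- d); split; [exact (is_derive_opp (V := R_NormedModule) f s d E)|].
      apply Rabs_le_between in L; lra. }
  rewrite Rmult_0_l, exp_0 in H1, H2; apply Rabs_le; lra.
Qed.

Lemma cluster_curve_restrict alpha beta T T' y :
  T' <= T -> cluster_curve alpha beta T y -> cluster_curve alpha beta T' y.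
Proof. intros HT [H1 H2]; split; [exact H1 | intros n s Hs; apply H2; lra]. Qed.

(** Bound on the speed of truncated rate sums. *)
Definition drift_const (K B M : R) : R :=
  2 * K * (K * M * (M + 1)) + B * (2 * K * M * M + K * M).

Lemma drift_const_nonneg K B M : 0 <= K -> 0 <= B -> 0 <= M -> 0 <= drift_const K B M.
Proof.
  intros HK HB HM; unfold drift_const; apply Rplus_le_le_0_compat;
    repeat apply Rmult_le_pos; try lra; apply Rplus_le_le_0_compat;
    repeat apply Rmult_le_pos; lra.
Qed.

(** Truncated rate sums vary at a bounded speed, uniformly in the truncation.  In the
    boundary term the rate and the flux are of order sqrt N and 1 / sqrt N. *)
Lemma rate_psum_drift K B M alpha beta th T y N :
  admissible K B alpha -> admissible K B beta -> admissible K B th ->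
  cluster_curve alpha beta T y -> 0 <= T ->
  (forall s, 0 <= s <= T -> bounded_state M (y s)) ->
  Rabs (psum (fun n => th n * y T n) N - psum (fun n => th n * y 0 n) N)
    <= drift_const K B M * T.
Proof.
  intros Ha Hb Ht [Hcont Hder] HT Hy.
  pose proof (adm_K_nonneg _ _ _ Ha) as HK; pose proof (adm_B_nonneg _ _ _ Ha) as HB.
  pose proof (bs_M_nonneg _ _ (Hy 0 ltac:(lra))) as HM.
  apply (lipschitz_of_derive (fun s => psum (fun n => th n * y s n) N)).
  - apply drift_const_nonneg; assumption.
  - exact HT.
  - intros s Hs; apply (psum_continuous (fun s n => th n * y s n)); intros i.
    apply (continuous_mult (K := R_AbsRing)); [apply continuous_const | apply Hcont].
  - intros s Hs; set (F := flux alpha beta (y s)).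
    assert (Hys : bounded_state M (y s)) by (apply Hy; lra).
    exists (psum (fun n => th n * (F (pred n) - F (pred (S n)))) N); split.
    + apply (psum_is_derive (fun s n => th n * y s n)); intros i Hi.
      apply (is_derive_scal (fun t => y t (S (S i)))), Hder, Hs.
    + rewrite (psum_abel th (fun n => F (pred n))); cbn [pred].
      assert (HF : forall n, (1 <= n)%nat -> Rabs (F n) <= K * M * (M + 1) / sqrt (INR n)).
      { intros n Hn; apply (flux_bound K B); assumption. }
      assert (P1 : Rabs (th 1%nat * F 1%nat) <= K * (K * M * (M + 1))).
      { specialize (HF 1%nat (le_n _)); simpl INR in HF; rewrite sqrt_1, Rdiv_1_r in HF.
        pose proof (adm_first _ _ _ Ht); pose proof (adm_nonneg _ _ _ Ht 1%nat (le_n _)) as T0.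
        rewrite Rabs_mult, (Rabs_pos_eq (th _)) by exact T0.
        apply Rmult_le_compat; try assumption; apply Rabs_pos. }
      assert (P3 : Rabs (th (S N) * F (S N)) <= K * (K * M * (M + 1))).
      { specialize (HF (S N) ltac:(lia)).
        pose proof (adm_growth _ _ _ Ht (S N) ltac:(lia)) as T1.
        pose proof (adm_nonneg _ _ _ Ht (S N) ltac:(lia)) as T0.
        destruct (sqrt_INR_facts (S N) ltac:(lia)) as [F1 _].
        rewrite Rabs_mult, (Rabs_pos_eq (th _)) by exact T0.
        set (q := sqrt (INR (S N))) in *.
        replace (K * (K * M * (M + 1))) with (K * q * (K * M * (M + 1) / q)) by (field; lra).
        apply Rmult_le_compat; try assumption; apply Rabs_pos. }
      assert (P2 : Rabs (psum (fun n => (th n - th (pred n)) * F (pred n)) N)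
                   <= B * (2 * K * M * M + K * M)).
      { eapply Rle_trans; [apply psum_abs|].
        apply Rle_trans with (psum (fun n => B *
           (M * (beta (pred n) * y s (pred n)) + alpha n * y s n)) N).
        - apply psum_le; intros i _; cbn [pred]; rewrite Rabs_mult.
          apply Rmult_le_compat; try apply Rabs_pos.
          + apply (adm_incr _ _ _ Ht); lia.
          + apply (flux_abs_le K B M); try assumption; lia.
        - rewrite psum_scal, psum_plus, psum_scal; apply Rmult_le_compat_l; [exact HB|].
          pose proof (rate_psum_shift_le K B M beta (y s) N Hb Hys).
          pose proof (rate_psum_le K B M alpha (y s) N Ha Hys). nra. }
      unfold drift_const.
      apply Rabs_le_between in P1; apply Rabs_le_between in P2; apply Rabs_le_between in P3.
      apply Rabs_le; lra.
Qed.

(** * Stability in the norm of tails *)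

(** The tail [e n + ... + e (p + 1)], for [n >= 2]. *)
Definition tail (p : nat) (e : nat -> R) (n : nat) : R :=
  psum e p - psum e (pred (pred n)).

Lemma tail_diff p e i : e (S (S i)) = tail p e (S (S i)) - tail p e (S (S (S i))).
Proof. unfold tail; cbn [pred psum]; ring. Qed.

Lemma tail_bound M p x v i :
  bounded_state M x -> bounded_state M v -> (i <= p)%nat ->
  INR (S i) * Rabs (tail p (fun n => x n - v n) (S (S i))) <= 2 * M.
Proof.
  intros Hx Hv Hi; unfold tail; cbn [pred].
  set (e := fun n => x n - v n).
  assert (Hp : 0 < INR (S i)) by (apply lt_0_INR; lia).
  assert (E : Rabs (psum e p - psum e i) <=
     psum (fun n => / INR (S i) * (INR n * x n + INR n * v n)) p
     - psum (fun n => / INR (S i) * (INR n * x n + INR n * v n)) i).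
  { apply psum_range_le; [exact Hi|]; intros j Hj; unfold e.
    pose proof (bs_nonneg _ _ Hx (S (S j)) ltac:(lia)) as X0.
    pose proof (bs_nonneg _ _ Hv (S (S j)) ltac:(lia)) as V0.
    apply Rle_trans with (1 * (x (S (S j)) + v (S (S j)))).
    - apply Rabs_le; lra.
    - rewrite <- Rmult_plus_distr_l, <- Rmult_assoc; apply Rmult_le_compat_r; [lra|].
      rewrite <- (Rinv_l (INR (S i))) by lra; apply Rmult_le_compat_l.
      + left; apply Rinv_0_lt_compat; exact Hp.
      + apply le_INR; lia. }
  rewrite !psum_scal, <- Rmult_minus_distr_l, !psum_plus in E.
  pose proof (bs_moment _ _ Hx p); pose proof (bs_moment _ _ Hv p).
  assert (P : forall y, bounded_state M y -> 0 <= psum (fun n => INR n * y n) i).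
  { intros y Hy; apply psum_pos; intros j; apply Rmult_le_pos; [apply pos_INR|].
    apply (bs_nonneg _ _ Hy); lia. }
  pose proof (P x Hx); pose proof (P v Hv).
  apply (Rmult_le_compat_l (INR (S i))) in E; [|lra].
  rewrite <- Rmult_assoc, Rinv_r, Rmult_1_l in E by lra. lra.
Qed.

Lemma rate_tail_bound K B M th p x v N :
  admissible K B th -> bounded_state M x -> bounded_state M v -> (N <= p)%nat ->
  th (S N) * Rabs (tail p (fun n => x n - v n) (S (S N))) <= 2 * K * M / sqrt (INR (S N)).
Proof.
  intros Ht Hx Hv HN; pose proof (tail_bound M p x v N Hx Hv HN) as E.
  pose proof (adm_growth _ _ _ Ht (S N) ltac:(lia)) as G; pose proof (adm_K_nonneg _ _ _ Ht).
  destruct (sqrt_INR_facts (S N) ltac:(lia)) as [F1 F2]; rewrite <- F2 in E.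
  set (q := sqrt (INR (S N))) in *; set (z := Rabs _) in *.
  assert (Hz : 0 <= z) by apply Rabs_pos.
  apply Rle_trans with (K * q * z); [apply Rmult_le_compat_r; assumption|].
  apply -> Rle_div_r; [|lra].
  replace (K * q * z * q) with (K * (q * q * z)) by ring; nra.
Qed.

(** The increments of the rates are bounded, so the rate sums are controlled by the sum of
    the tails, although in general not by the l2 norm of the difference. *)
Lemma rate_diff_le_tails K B M th p x v N :
  admissible K B th -> bounded_state M x -> bounded_state M v -> (1 <= N <= p)%nat ->
  Rabs (psum (fun n => th n * (x n - v n)) N)
  <= (K + B) * psum (fun n => Rabs (tail p (fun n => x n - v n) n)) N
     + 2 * K * M / sqrt (INR (S N)).
Proof.
  intros Ht Hx Hv [HN1 HN]; set (e := fun n => x n - v n); set (d := tail p e).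
  pose proof (adm_K_nonneg _ _ _ Ht) as HK; pose proof (adm_B_nonneg _ _ _ Ht) as HB.
  rewrite (psum_ext _ (fun n => th n * (d n - d (S n)))).
  2: { intros i; unfold d; rewrite <- tail_diff; reflexivity. }
  rewrite psum_abel.
  pose proof (rate_tail_bound K B M th p x v N Ht Hx Hv HN) as P3; fold e d in P3.
  assert (P2 : Rabs (psum (fun n => (th n - th (pred n)) * d n) N)
               <= B * psum (fun n => Rabs (d n)) N).
  { eapply Rle_trans; [apply psum_abs|]; rewrite <- psum_scal; apply psum_le.
    intros i _; rewrite Rabs_mult; apply Rmult_le_compat_r; [apply Rabs_pos|].
    apply (adm_incr _ _ _ Ht); lia. }
  assert (P1 : Rabs (th 1%nat * d 2%nat) <= K * psum (fun n => Rabs (d n)) N).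
  { rewrite Rabs_mult, (Rabs_pos_eq (th _)) by (apply (adm_nonneg _ _ _ Ht); lia).
    apply Rmult_le_compat; [apply (adm_nonneg _ _ _ Ht); lia | apply Rabs_pos
      | apply (adm_first _ _ _ Ht) |].
    apply (psum_term (fun n => Rabs (d n)) N 0); [intros; apply Rabs_pos | lia]. }
  assert (P4 : Rabs (th (S N) * d (S (S N))) <= 2 * K * M / sqrt (INR (S N))).
  { rewrite Rabs_mult, (Rabs_pos_eq (th _)) by (apply (adm_nonneg _ _ _ Ht); lia); exact P3. }
  apply Rabs_le_between in P1; apply Rabs_le_between in P2; apply Rabs_le_between in P4.
  apply Rabs_le; lra.
Qed.


(** Growth moves tails up.  For sizes [n >= 3] convexity gives a telescoping sum; for [n = 2]
    the value [d 1 - d 2] is replaced by the monomer error [e0].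
    The slope of the convex function is [dsabs]. *)
Lemma growth_transport K B beta eps e0 (d : nat -> R) N :
  admissible K B beta -> 0 < eps -> (1 <= N)%nat ->
  psum (fun n => dsabs eps (d n) *
          (beta (pred n) * match pred n with 1%nat => e0 | _ => d (pred n) - d n end)) N
  <= K * Rabs e0 + (K + B) * psum (fun n => sabs eps (d n)) N.
Proof.
  intros Hb He HN; destruct N as [|N]; [lia|]; clear HN.
  pose proof (adm_B_nonneg _ _ _ Hb) as HB.
  assert (Hs : forall n, 0 <= sabs eps (d n)) by (intros; left; apply sabs_pos, He).
  set (G := fun n => dsabs eps (d n) *
          (beta (pred n) * match pred n with 1%nat => e0 | _ => d (pred n) - d n end)).
  assert (H : psum G (S N) + beta (S N) * sabs eps (d (S (S N)))
    <= K * Rabs e0 + K * sabs eps (d 2%nat)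
       + B * (psum (fun n => sabs eps (d n)) (S N) - sabs eps (d (S (S N))))).
  { induction N as [|N IH].
    - unfold G; cbn [psum pred].
      pose proof (dsabs_mul_le eps (d 2%nat) e0 He) as P.
      pose proof (adm_first _ _ _ Hb); pose proof (adm_nonneg _ _ _ Hb 1%nat (le_n _)).
      pose proof (Hs 2%nat); pose proof (Rabs_pos e0).
      assert (beta 1%nat * (dsabs eps (d 2%nat) * e0) <= K * Rabs e0).
      { apply Rle_trans with (beta 1%nat * Rabs e0);
          [apply Rmult_le_compat_l | apply Rmult_le_compat_r]; assumption. }
      assert (beta 1%nat * sabs eps (d 2%nat) <= K * sabs eps (d 2%nat))
        by (apply Rmult_le_compat_r; assumption).
      lra.
    - change (psum G (S (S N))) with (psum G (S N) + G (S (S (S N)))).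
      change (psum (fun n => sabs eps (d n)) (S (S N)))
        with (psum (fun n => sabs eps (d n)) (S N) + sabs eps (d (S (S (S N))))).
      unfold G at 2; cbn [pred].
      pose proof (dsabs_convex eps (d (S (S (S N)))) (d (S (S N))) He) as P.
      pose proof (adm_nonneg _ _ _ Hb (S (S N)) ltac:(lia)) as b0.
      pose proof (adm_incr _ _ _ Hb (S N) ltac:(lia)) as b1; apply Rabs_le_between in b1.
      pose proof (Hs (S (S N))) as s2.
      apply (Rmult_le_compat_l _ _ _ b0) in P.
      assert ((beta (S (S N)) - beta (S N)) * sabs eps (d (S (S N)))
              <= B * sabs eps (d (S (S N)))) by (apply Rmult_le_compat_r; lra).
      lra. }
  assert (sabs eps (d 2%nat) <= psum (fun n => sabs eps (d n)) (S N)).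
  { apply (psum_term (fun n => sabs eps (d n)) (S N) 0); [intros; apply Hs | lia]. }
  assert (0 <= beta (S N) * sabs eps (d (S (S N)))).
  { apply Rmult_le_pos; [apply (adm_nonneg _ _ _ Hb); lia | apply Hs]. }
  pose proof (adm_K_nonneg _ _ _ Hb); pose proof (Hs (S (S N))).
  assert (K * sabs eps (d 2%nat) <= K * psum (fun n => sabs eps (d n)) (S N))
    by (apply Rmult_le_compat_l; assumption).
  assert (0 <= B * sabs eps (d (S (S N)))) by (apply Rmult_le_pos; assumption).
  lra.
Qed.

(** Fragmentation moves tails down; the last term is the boundary term of the truncation. *)
Lemma shrink_transport K B alpha eps (d : nat -> R) N :
  admissible K B alpha -> 0 < eps ->
  psum (fun n => dsabs eps (d n) * (alpha n * (d (S n) - d n))) N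
  <= B * psum (fun n => sabs eps (d n)) N + alpha (S N) * sabs eps (d (S (S N))).
Proof.
  intros Ha He; assert (Hs : forall n, 0 <= sabs eps (d n)) by (intros; left; apply sabs_pos, He).
  induction N as [|N IH]; cbn [psum].
  - assert (0 <= alpha 1%nat * sabs eps (d 2%nat)); [|lra].
    apply Rmult_le_pos; [apply (adm_nonneg _ _ _ Ha); lia | apply Hs].
  - pose proof (dsabs_convex eps (d (S (S N))) (d (S (S (S N)))) He) as P.
    pose proof (adm_nonneg _ _ _ Ha (S (S N)) ltac:(lia)) as a0.
    pose proof (adm_incr _ _ _ Ha (S N) ltac:(lia)) as a1; apply Rabs_le_between in a1.
    apply (Rmult_le_compat_l _ _ _ a0) in P.
    assert ((alpha (S N) - alpha (S (S N))) * sabs eps (d (S (S N)))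
            <= B * sabs eps (d (S (S N)))) by (apply Rmult_le_compat_r; [apply Hs | lra]).
    lra.
Qed.

(** The left-hand side is the time derivative of the sum of the smoothed absolute values of
    the tails of [x - v], when [x] and [v] follow the cluster equations. *)
Lemma tail_sum_rate K B M alpha beta eps p (x v : nat -> R) N :
  admissible K B alpha -> admissible K B beta -> bounded_state M x -> bounded_state M v ->
  0 < eps -> (1 <= N <= p)%nat ->
  let d := tail p (fun n => x n - v n) in
  psum (fun n => dsabs eps (d n) *
          ((flux alpha beta x (pred n) - flux alpha beta v (pred n))
           - (flux alpha beta x (S p) - flux alpha beta v (S p)))) N
  <= (M * (K + B) + B) * psum (fun n => sabs eps (d n)) N
     + 3 * K * M * Rabs (x 1%nat - v 1%nat)
     + (2 * K * M / sqrt (INR (S N)) + alpha (S N) * eps)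
     + 2 * (K * M * (M + 1)) * (INR N / sqrt (INR (S p))).
Proof.
  intros Ha Hb Hx Hv He [HN1 HN] d.
  pose proof (adm_K_nonneg _ _ _ Ha) as HK; pose proof (adm_B_nonneg _ _ _ Ha) as HB.
  pose proof (bs_M_nonneg _ _ Hx) as HM.
  set (e0 := x 1%nat - v 1%nat).
  set (Sg := psum (fun n => sabs eps (d n)) N).
  assert (HSg : 0 <= Sg) by (apply psum_pos; intros; left; apply sabs_pos, He).
  set (c := v 1%nat).
  assert (Hc : 0 <= c <= M).
  { split; [apply (bs_nonneg _ _ Hv); lia | apply (bs_first _ _ Hv)]. }
  set (J := K * M * (M + 1) / sqrt (INR (S p))).
  assert (HJx : Rabs (flux alpha beta x (S p)) <= J) by (apply (flux_bound K B); [assumption.. | lia]).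
  assert (HJv : Rabs (flux alpha beta v (S p)) <= J) by (apply (flux_bound K B); [assumption.. | lia]).
  apply Rle_trans with (psum (fun n =>
     c * (dsabs eps (d n) *
          (beta (pred n) * match pred n with 1%nat => e0 | _ => d (pred n) - d n end))
     + (dsabs eps (d n) * (alpha n * (d (S n) - d n)))
     + (Rabs e0 * (beta (pred n) * x (pred n)) + 2 * J)) N).
  - apply psum_le; intros i _; cbn [pred].
    assert (Di : x (S (S i)) - v (S (S i)) = d (S (S i)) - d (S (S (S i)))).
    { unfold d; rewrite <- tail_diff; reflexivity. }
    assert (Dp : match S i with 1%nat => e0 | _ => d (S i) - d (S (S i)) end
                 = x (S i) - v (S i)).
    { destruct i as [|i]; [reflexivity|]; unfold d; rewrite <- tail_diff; reflexivity. }
    rewrite Dp; clear Dp.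
    set (F := flux alpha beta x (S p) - flux alpha beta v (S p)).
    assert (HF : Rabs (- F) <= 2 * J).
    { unfold F; apply Rabs_le_between in HJx; apply Rabs_le_between in HJv; apply Rabs_le; lra. }
    pose proof (dsabs_mul_le eps (d (S (S i))) (- F) He) as P1.
    pose proof (dsabs_mul_le eps (d (S (S i))) (beta (S i) * x (S i) * e0) He) as P2.
    destruct (rate_term_bound K B M beta x (S i) Hb Hx ltac:(lia)) as [bx _].
    rewrite Rabs_mult, (Rabs_pos_eq _ bx) in P2.
    unfold flux.
    replace (beta (S i) * x 1%nat * x (S i) - alpha (S (S i)) * x (S (S i))
             - (beta (S i) * v 1%nat * v (S i) - alpha (S (S i)) * v (S (S i))) - F)
      with (c * (beta (S i) * (x (S i) - v (S i))) + beta (S i) * x (S i) * e0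
            - alpha (S (S i)) * (x (S (S i)) - v (S (S i))) + - F)
      by (unfold c, e0; ring).
    rewrite Di. lra.
  - rewrite !psum_plus, !psum_scal, psum_const.
    pose proof (growth_transport K B beta eps e0 d N Hb He HN1) as Q1; fold Sg in Q1.
    pose proof (shrink_transport K B alpha eps d N Ha He) as Q2; fold Sg in Q2.
    pose proof (rate_psum_shift_le K B M beta x N Hb Hx) as Q3.
    pose proof (Rabs_pos e0) as E0.
    assert (R1 : c * psum (fun n => dsabs eps (d n) *
          (beta (pred n) * match pred n with 1%nat => e0 | _ => d (pred n) - d n end)) N
          <= M * (K * Rabs e0 + (K + B) * Sg)).
    { apply Rle_trans with (c * (K * Rabs e0 + (K + B) * Sg)).
      - apply Rmult_le_compat_l; [tauto | exact Q1].
      - apply Rmult_le_compat_r; [|tauto].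
        apply Rplus_le_le_0_compat; apply Rmult_le_pos; lra. }
    assert (R3 : Rabs e0 * psum (fun n => beta (pred n) * x (pred n)) N
                 <= Rabs e0 * (2 * K * M)) by (apply Rmult_le_compat_l; assumption).
    assert (R2 : alpha (S N) * sabs eps (d (S (S N)))
                 <= 2 * K * M / sqrt (INR (S N)) + alpha (S N) * eps).
    { pose proof (sabs_le eps (d (S (S N))) He) as L.
      pose proof (rate_tail_bound K B M alpha p x v N Ha Hx Hv HN) as L'; fold d in L'.
      pose proof (adm_nonneg _ _ _ Ha (S N) ltac:(lia)) as a0.
      apply (Rmult_le_compat_l _ _ _ a0) in L. lra. }
    assert (R4 : 2 * (INR N * J) = 2 * (K * M * (M + 1)) * (INR N / sqrt (INR (S p))))
      by (unfold J, Rdiv; ring).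
    rewrite R4. lra.
Qed.

(** Cutoff of the tails when [N] of them are summed: large enough for the [N] boundary
    fluxes at the cutoff, each of order [1 / sqrt (cutoff N)], to be negligible. *)
Definition cutoff (N : nat) : nat := (S N ^ 4)%nat.

Lemma cutoff_ge N : (N <= cutoff N)%nat.
Proof. unfold cutoff; simpl; nia. Qed.

Lemma cutoff_sqrt N : INR N / sqrt (INR (S (cutoff N))) <= / INR (S N).
Proof.
  assert (H : INR (S N) * INR (S N) <= sqrt (INR (S (cutoff N)))).
  { rewrite <- (sqrt_square (INR (S N) * INR (S N))).
    - apply sqrt_le_1_alt; unfold cutoff; rewrite (S_INR (S N ^ 4)), pow_INR; lra.
    - apply Rmult_le_pos; apply pos_INR. }
  assert (HN : 0 < INR (S N)) by (apply lt_0_INR; lia).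
  assert (Hp : 0 < INR (S N) * INR (S N)) by (apply Rmult_lt_0_compat; exact HN).
  assert (HS : INR N <= INR (S N)) by (apply le_INR; lia).
  apply Rle_div_l; [lra|].
  apply Rle_trans with (/ INR (S N) * (INR (S N) * INR (S N))).
  - rewrite <- Rmult_assoc, Rinv_l by lra; lra.
  - apply Rmult_le_compat_l; [left; apply Rinv_0_lt_compat; exact HN | exact H].
Qed.

(** Truncated distance between two states: the monomers and the first [N] tails. *)
Definition tail_err (N : nat) (x y : nat -> R) : R :=
  Rabs (x 1%nat - y 1%nat)
  + psum (fun n => Rabs (tail (cutoff N) (fun n => x n - y n) n)) N.

(** Bound on the speed of the monomers. *)
Definition speed_const (K M : R) : R := 2 * K * M ^ 2 + K * M * M + K * M.

(** Rate in the Gronwall inequality over one step: the three lines are the coefficients of the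
    error, of the step length and of the truncation error. *)
Definition step_const (K B M : R) : R :=
  ((M + 1) * (K + B) + M * (K + B) + B + 3 * K * M)
  + ((M + 1) * drift_const K B M + 6 * K * M * speed_const K M)
  + ((M + 1) * (4 * K * M) + 2 * K * M + K + 2 * (K * M * (M + 1))).

Lemma tail_is_derive alpha beta T X V p s i :
  cluster_curve alpha beta T X -> cluster_curve alpha beta T V -> 0 < s < T ->
  is_derive (fun t => tail p (fun n => X t n - V t n) (S (S i))) s
    ((flux alpha beta (X s) (S i) - flux alpha beta (V s) (S i))
     - (flux alpha beta (X s) (S p) - flux alpha beta (V s) (S p))).
Proof.
  intros [_ HX] [_ HV] Hs; unfold tail; cbn [pred].
  set (F := fun n => flux alpha beta (X s) (pred n) - flux alpha beta (V s) (pred n)).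
  assert (H : forall k, is_derive (fun t => psum (fun n => X t n - V t n) k) s
                          (F 2%nat - F (S (S k)))).
  { intros k; rewrite <- psum_telescope.
    apply (psum_is_derive (fun t n => X t n - V t n)); intros j _.
    replace (F (S (S j)) - F (S (S (S j)))) with
      ((flux alpha beta (X s) (S j) - flux alpha beta (X s) (S (S j)))
       - (flux alpha beta (V s) (S j) - flux alpha beta (V s) (S (S j))))
      by (unfold F; cbn [pred]; ring).
    apply (is_derive_minus (V := R_NormedModule)); [apply HX | apply HV]; exact Hs. }
  replace (flux alpha beta (X s) (S i) - flux alpha beta (V s) (S i)
           - (flux alpha beta (X s) (S p) - flux alpha beta (V s) (S p)))
    with ((F 2%nat - F (S (S p))) - (F 2%nat - F (S (S i))))
    by (unfold F; cbn [pred]; ring).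
  apply (is_derive_minus (V := R_NormedModule)); apply H.
Qed.

Lemma tail_continuous alpha beta T X V p s i :
  cluster_curve alpha beta T X -> cluster_curve alpha beta T V ->
  continuous (fun t => tail p (fun n => X t n - V t n) (S (S i))) s.
Proof.
  intros [HX _] [HV _]; unfold tail; cbn [pred].
  apply (continuous_minus (V := R_NormedModule));
    apply (psum_continuous (fun t n => X t n - V t n)); intros j;
    apply (continuous_minus (V := R_NormedModule)); [apply HX | apply HV | apply HX | apply HV].
Qed.

(** Over one step, rate sums at [X s] are close to the frozen ones at [V 0]. *)
Lemma frozen_rate_diff K B M alpha beta th h X V s N :
  admissible K B alpha -> admissible K B beta -> admissible K B th ->
  cluster_curve alpha beta h V -> 0 <= s <= h ->
  bounded_state M (X s) -> (forall s, 0 <= s <= h -> bounded_state M (V s)) -> (1 <= N)%nat ->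
  Rabs (sum_from_2 (fun n => th n * X s n) - sum_from_2 (fun n => th n * V 0 n))
  <= (K + B) * psum (fun n => Rabs (tail (cutoff N) (fun n => X s n - V s n) n)) N
     + 4 * K * M / sqrt (INR (S N)) + drift_const K B M * h.
Proof.
  intros Ha Hb Ht HV Hs HX HVb HN.
  pose proof (rate_sum_tail K B M th (X s) N Ht HX) as T1.
  pose proof (rate_sum_tail K B M th (V 0) N Ht (HVb 0 ltac:(lra))) as T2.
  pose proof (rate_diff_le_tails K B M th (cutoff N) (X s) (V s) N Ht HX (HVb s Hs)
                (conj HN (cutoff_ge N))) as T3.
  rewrite (psum_ext _ (fun n => th n * X s n - th n * V s n)), psum_minus in T3
    by (intros; ring).
  pose proof (rate_psum_drift K B M alpha beta th s V N Ha Hb Ht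
                (cluster_curve_restrict _ _ _ _ _ (proj2 Hs) HV) (proj1 Hs)
                (fun r Hr => HVb r ltac:(lra))) as T4.
  pose proof (drift_const_nonneg K B M (adm_K_nonneg _ _ _ Ha) (adm_B_nonneg _ _ _ Ha)
                (bs_M_nonneg _ _ HX)) as Hd.
  assert (drift_const K B M * s <= drift_const K B M * h) by (apply Rmult_le_compat_l; lra).
  replace (4 * K * M / sqrt (INR (S N)))
    with (2 * K * M / sqrt (INR (S N)) + 2 * (K * M / sqrt (INR (S N)))) by (unfold Rdiv; ring).
  apply Rabs_le_between in T3; apply Rabs_le_between in T4; apply Rabs_le; lra.
Qed.

(** Right-hand side of the monomer equation with clusters [U]; [kappa n] is the rate at which
    a cluster of size [n] releases monomers. *)
Definition monomer_rhs (beta kappa U : nat -> R) (w : R) : R :=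
  - 2 * beta 1%nat * w ^ 2 - sum_from_2 (fun n => beta n * U n) * w
  + sum_from_2 (fun n => kappa n * U n).

Lemma monomer_rhs_bound K B M beta kappa U w :
  admissible K B beta -> admissible K B kappa -> bounded_state M U -> 0 <= w <= M ->
  Rabs (monomer_rhs beta kappa U w) <= speed_const K M.
Proof.
  intros Hb Hk HU Hw; unfold monomer_rhs, speed_const.
  pose proof (rate_sum_bounds K B M beta U Hb HU) as S1.
  pose proof (rate_sum_bounds K B M kappa U Hk HU) as S2.
  set (b := sum_from_2 (fun n => beta n * U n)) in *.
  set (k := sum_from_2 (fun n => kappa n * U n)) in *.
  pose proof (adm_first _ _ _ Hb) as b1; pose proof (adm_nonneg _ _ _ Hb 1%nat (le_n _)) as b0.
  assert (0 <= w ^ 2 <= M ^ 2) by (split; [apply pow2_ge_0 | apply pow_incr; exact Hw]).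
  assert (0 <= beta 1%nat * w ^ 2 <= K * M ^ 2).
  { split; [apply Rmult_le_pos; tauto | apply Rmult_le_compat; tauto]. }
  assert (0 <= b * w <= K * M * M).
  { split; [apply Rmult_le_pos; tauto | apply Rmult_le_compat; tauto]. }
  apply Rabs_le; lra.
Qed.

(** Quadratic and linear losses are dissipative: the monomer error only grows through the
    errors on the rate sums. *)
Lemma monomer_err_rate K B M beta kappa eps (X U : nat -> R) (x w D : R) :
  admissible K B beta -> bounded_state M X -> 0 < eps -> 0 <= x <= M -> 0 <= w <= M ->
  Rabs (sum_from_2 (fun n => beta n * X n) - sum_from_2 (fun n => beta n * U n)) <= D ->
  Rabs (sum_from_2 (fun n => kappa n * X n) - sum_from_2 (fun n => kappa n * U n)) <= D ->
  dsabs eps (x - w) * (monomer_rhs beta kappa X x - monomer_rhs beta kappa U w)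
  <= (M + 1) * D.
Proof.
  intros Hb HX He Hx Hw H1 H2; unfold monomer_rhs.
  pose proof (rate_sum_bounds K B M beta X Hb HX) as S1.
  set (bX := sum_from_2 (fun n => beta n * X n)) in *.
  set (bU := sum_from_2 (fun n => beta n * U n)) in *.
  set (kX := sum_from_2 (fun n => kappa n * X n)) in *.
  set (kU := sum_from_2 (fun n => kappa n * U n)) in *.
  set (g := dsabs eps (x - w)).
  pose proof (dsabs_sign eps (x - w) He) as G; fold g in G.
  pose proof (dsabs_mul_le eps (x - w) (w * (bU - bX)) He) as P1; fold g in P1.
  pose proof (dsabs_mul_le eps (x - w) (kX - kU) He) as P2; fold g in P2.
  rewrite Rabs_mult, (Rabs_pos_eq w), (Rabs_minus_sym bU) in P1 by tauto.
  assert (P1' : w * Rabs (bX - bU) <= M * D).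
  { apply Rmult_le_compat; try tauto; apply Rabs_pos. }
  pose proof (adm_nonneg _ _ _ Hb 1%nat (le_n _)) as b0.
  assert (P0 : 0 <= (2 * beta 1%nat * (x + w) + bX) * (g * (x - w))).
  { apply Rmult_le_pos; [|exact G]; apply Rplus_le_le_0_compat; [|tauto].
    apply Rmult_le_pos; lra. }
  replace (g * _) with (- ((2 * beta 1%nat * (x + w) + bX) * (g * (x - w)))
     + g * (w * (bU - bX)) + g * (kX - kU)) by ring.
  lra.
Qed.

Lemma step_const_nonneg K B M : 0 <= K -> 0 <= B -> 0 <= M -> 0 <= step_const K B M.
Proof.
  intros HK HB HM; pose proof (drift_const_nonneg K B M HK HB HM).
  assert (0 <= K * M) by (apply Rmult_le_pos; assumption).
  assert (0 <= speed_const K M).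
  { unfold speed_const; pose proof (pow2_ge_0 M).
    assert (0 <= K * M ^ 2) by (apply Rmult_le_pos; assumption).
    assert (0 <= K * M * M) by (apply Rmult_le_pos; assumption). lra. }
  unfold step_const; repeat apply Rplus_le_le_0_compat; repeat apply Rmult_le_pos; lra.
Qed.

(** Error propagation over one step.  [X] is the exact solution, [w] the monomers and [V] the
    clusters of the scheme; the coordinate 1 of [V] is constant, equal to the updated monomer
    value [w h]. *)
Lemma one_step K B M alpha beta kappa h X V (w : R -> R) N :
  admissible K B alpha -> admissible K B beta -> admissible K B kappa ->
  cluster_curve alpha beta h X -> cluster_curve alpha beta h V -> 0 <= h ->
  (forall s, 0 <= s <= h -> bounded_state M (X s)) ->
  (forall s, 0 <= s <= h -> bounded_state M (V s)) ->
  (forall s, 0 <= s <= h -> 0 <= w s <= M) ->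
  (forall s, 0 <= s <= h -> continuous w s) ->
  (forall s, 0 < s < h -> is_derive w s (monomer_rhs beta kappa (V 0) (w s))) ->
  (forall s, 0 < s < h ->
     is_derive (fun t => X t 1%nat) s (monomer_rhs beta kappa (X s) (X s 1%nat))) ->
  (forall s, 0 <= s <= h -> V s 1%nat = w h) ->
  (1 <= N)%nat ->
  let err s := Rabs (X s 1%nat - w s)
    + psum (fun n => Rabs (tail (cutoff N) (fun n => X s n - V s n) n)) N in
  let r := / sqrt (INR (S N)) in
  err h <= exp (step_const K B M * h) * (err 0 + r + step_const K B M * (h + r) * h).
Proof.
  intros Ha Hb Hk HX HV Hh HXb HVb Hwb Hwc Hwd HX1 HV1 HN err r.
  set (p := cutoff N); set (C := step_const K B M).
  pose proof (adm_K_nonneg _ _ _ Ha) as HK; pose proof (adm_B_nonneg _ _ _ Ha) as HB.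
  pose proof (bs_M_nonneg _ _ (HXb 0 ltac:(lra))) as HM.
  pose proof (step_const_nonneg K B M HK HB HM) as HC; fold C in HC.
  destruct (sqrt_INR_facts (S N) ltac:(lia)) as [F1 F2].
  assert (HN1 : 0 < INR (S N)) by (apply lt_0_INR; lia).
  assert (Hr : 0 < r) by (apply Rinv_0_lt_compat; lra).
  assert (HrN : / INR (S N) <= r) by (apply Rinv_le_contravar; lra).
  (* With this choice the [N + 1] smoothing errors add up to at most [r]. *)
  set (eps := / (INR (S N) * INR (S N))).
  assert (He : 0 < eps) by (apply Rinv_0_lt_compat, Rmult_lt_0_compat; exact HN1).
  assert (HeN : INR (S N) * eps <= r).
  { unfold eps; rewrite Rinv_mult, <- Rmult_assoc, Rinv_r, Rmult_1_l by lra; exact HrN. }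
  set (d := fun s => tail p (fun n => X s n - V s n)).
  set (E := fun s => sabs eps (X s 1%nat - w s) + psum (fun n => sabs eps (d s n)) N).
  assert (HE0 : forall s, err s <= E s).
  { intros s; unfold err, E; apply Rplus_le_compat; [apply Rabs_le_sabs|].
    apply psum_le; intros; apply Rabs_le_sabs. }
  assert (HE1 : E 0 <= err 0 + r).
  { unfold E, err; pose proof (sabs_le eps (X 0 1%nat - w 0) He).
    assert (psum (fun n => sabs eps (d 0 n)) N <= psum (fun n => Rabs (d 0 n) + eps) N)
      by (apply psum_le; intros; apply sabs_le, He).
    rewrite psum_plus, psum_const in H0. fold p; rewrite S_INR in HeN; unfold d in *. lra. }
  eapply Rle_trans; [apply HE0|].
  apply Rle_trans with (exp (C * h) * (E 0 + C * (h + r) * h));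
    [|apply Rmult_le_compat_l; [left; apply exp_pos | lra]].
  apply gronwall; [exact HC | apply Rmult_le_pos; lra | exact Hh | |].
  { intros s Hs; unfold E; apply (continuous_plus (V := R_NormedModule)).
    - apply continuous_sabs_comp; [exact He|].
      apply (continuous_minus (V := R_NormedModule)); [apply HX | apply Hwc, Hs].
    - apply (psum_continuous (fun s n => sabs eps (d s n))); intros i.
      apply (continuous_sabs_comp eps (fun s => d s (S (S i)))); [exact He|].
      apply (tail_continuous alpha beta h); assumption. }
  intros s Hs.
  assert (Hs' : 0 <= s <= h) by lra.
  exists (dsabs eps (X s 1%nat - w s) *
            (monomer_rhs beta kappa (X s) (X s 1%nat) - monomer_rhs beta kappa (V 0) (w s))
          + psum (fun n => dsabs eps (d s n) *
              ((flux alpha beta (X s) (pred n) - flux alpha beta (V s) (pred n))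
               - (flux alpha beta (X s) (S p) - flux alpha beta (V s) (S p)))) N).
  split.
  { unfold E; apply (is_derive_plus (V := R_NormedModule)).
    - apply (is_derive_sabs_comp eps (fun s => X s 1%nat - w s)); [exact He|].
      apply (is_derive_minus (V := R_NormedModule)); [apply HX1, Hs | apply Hwd, Hs].
    - apply (psum_is_derive (fun s n => sabs eps (d s n))); intros i _; cbn [pred].
      apply (is_derive_sabs_comp eps (fun s => d s (S (S i)))); [exact He|].
      apply (tail_is_derive alpha beta h); assumption. }
  set (Sg := psum (fun n => sabs eps (d s n)) N).
  set (A := psum (fun n => Rabs (d s n)) N).
  (* [D1] and [D2] bound the effect of freezing the clusters, [HCw] below that of using in the
     cluster equations the monomer value at the end of the step. *)
  assert (HA : 0 <= A <= Sg).
  { split; [apply psum_pos; intros; apply Rabs_pos|].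
    apply psum_le; intros; apply Rabs_le_sabs. }
  pose proof (frozen_rate_diff K B M alpha beta beta h X V s N Ha Hb Hb HV Hs'
                (HXb s Hs') HVb HN) as D1.
  pose proof (frozen_rate_diff K B M alpha beta kappa h X V s N Ha Hb Hk HV Hs'
                (HXb s Hs') HVb HN) as D2.
  fold p in D1, D2; fold (d s) in D1, D2; fold A in D1, D2.
  assert (Hx1 : 0 <= X s 1%nat <= M).
  { split; [apply (bs_nonneg _ _ (HXb s Hs')); lia | apply (bs_first _ _ (HXb s Hs'))]. }
  pose proof (monomer_err_rate K B M beta kappa eps (X s) (V 0) (X s 1%nat) (w s) _ Hb
                (HXb s Hs') He Hx1 (Hwb s Hs') D1 D2) as P1.
  pose proof (tail_sum_rate K B M alpha beta eps p (X s) (V s) N Ha Hb (HXb s Hs')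
                (HVb s Hs') He (conj HN (cutoff_ge N))) as P2.
  cbv zeta in P2; fold (d s) in P2; fold Sg in P2; rewrite (HV1 s Hs') in P2.
  set (e1 := sabs eps (X s 1%nat - w s)) in *.
  assert (He1 : 0 <= e1) by (left; apply sabs_pos, He).
  set (Cw := speed_const K M).
  assert (HCw : Rabs (w s - w h) <= 2 * Cw * h).
  { assert (L : forall t, 0 <= t <= h -> Rabs (w t - w 0) <= Cw * t).
    { intros t Ht; apply lipschitz_of_derive; [|apply Ht | |].
      - eapply Rle_trans; [apply Rabs_pos|].
        apply (monomer_rhs_bound K B M beta kappa (V 0) (w 0) Hb Hk (HVb 0 ltac:(lra))
                 (Hwb 0 ltac:(lra))).
      - intros q Hq; apply Hwc; lra.
      - intros q Hq; eexists; split; [apply Hwd; lra|].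
        apply (monomer_rhs_bound K B); try assumption; [apply HVb; lra | apply Hwb; lra]. }
    pose proof (L s Hs') as L1; pose proof (L h ltac:(lra)) as L2.
    assert (HCw0 : 0 <= Cw).
    { eapply Rle_trans; [apply Rabs_pos|].
      apply (monomer_rhs_bound K B M beta kappa (V 0) (w 0) Hb Hk (HVb 0 ltac:(lra))
               (Hwb 0 ltac:(lra))). }
    assert (Cw * s <= Cw * h) by (apply Rmult_le_compat_l; lra).
    apply Rabs_le_between in L1; apply Rabs_le_between in L2; apply Rabs_le; lra. }
  assert (Hxh : Rabs (X s 1%nat - w h) <= e1 + 2 * Cw * h).
  { pose proof (Rabs_le_sabs eps (X s 1%nat - w s)) as L; fold e1 in L.
    apply Rabs_le_between in L; apply Rabs_le_between in HCw; apply Rabs_le; lra. }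
  assert (HKM : 0 <= K * M) by (apply Rmult_le_pos; assumption).
  assert (Q1 : 3 * K * M * Rabs (X s 1%nat - w h) <= 3 * K * M * (e1 + 2 * Cw * h))
    by (apply Rmult_le_compat_l; lra).
  assert (Q2 : alpha (S N) * eps <= K * r).
  { apply Rle_trans with (K * INR (S N) * eps).
    - apply Rmult_le_compat_r; [lra|]; apply (adm_linear _ _ _ _ Ha); lia.
    - rewrite Rmult_assoc; apply Rmult_le_compat_l; assumption. }
  assert (Q3 : 2 * (K * M * (M + 1)) * (INR N / sqrt (INR (S p))) <= 2 * (K * M * (M + 1)) * r).
  { apply Rmult_le_compat_l.
    - apply Rmult_le_pos; [lra|]; apply Rmult_le_pos; lra.
    - eapply Rle_trans; [apply cutoff_sqrt | exact HrN]. }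
  assert (Q4 : (K + B) * A <= (K + B) * Sg) by (apply Rmult_le_compat_l; lra).
  assert (Q5 : (M + 1) * ((K + B) * A + 4 * K * M / sqrt (INR (S N)) + drift_const K B M * h)
     <= (M + 1) * ((K + B) * Sg + 4 * K * M * r + drift_const K B M * h)).
  { apply Rmult_le_compat_l; [lra|]; unfold r, Rdiv; lra. }
  change (2 * K * M / sqrt (INR (S N))) with (2 * K * M * r) in P2.
  set (C0 := (M + 1) * (K + B) + M * (K + B) + B + 3 * K * M).
  set (C1 := (M + 1) * drift_const K B M + 6 * K * M * Cw).
  set (C2 := (M + 1) * (4 * K * M) + 2 * K * M + K + 2 * (K * M * (M + 1))).
  assert (HCe : C = C0 + C1 + C2) by reflexivity.
  assert (HCw0 : 0 <= Cw * h) by (pose proof (Rabs_pos (w s - w h)); lra).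
  assert (H0 : 0 <= C0 /\ 0 <= C1 /\ 0 <= C2).
  { pose proof (drift_const_nonneg K B M HK HB HM).
    assert (0 <= Cw).
    { eapply Rle_trans; [apply Rabs_pos|].
      apply (monomer_rhs_bound K B M beta kappa (V 0) (w 0) Hb Hk (HVb 0 ltac:(lra))
               (Hwb 0 ltac:(lra))). }
    unfold C0, C1, C2; repeat split; repeat apply Rplus_le_le_0_compat;
      repeat apply Rmult_le_pos; lra. }
  apply Rle_trans with (C0 * (e1 + Sg) + C1 * h + C2 * r).
  - assert (M * (K + B) * e1 >= 0 /\ (M + 1) * (K + B) * e1 >= 0 /\ B * e1 >= 0 /\ K * M * Sg >= 0).
    { repeat split; apply Rle_ge; repeat apply Rmult_le_pos; lra. }
    unfold C0, C1, C2. lra.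
  - rewrite HCe; change (E s) with (e1 + Sg).
    assert (C0 * (e1 + Sg) <= (C0 + C1 + C2) * (e1 + Sg)) by (apply Rmult_le_compat_r; lra).
    assert (C1 * h <= (C0 + C1 + C2) * h) by (apply Rmult_le_compat_r; lra).
    assert (C2 * r <= (C0 + C1 + C2) * r) by (apply Rmult_le_compat_r; lra).
    lra.
Qed.

(** * Coordinates of curves in l2 *)

Lemma is_derive_of_within (f : R -> R) t l :
  0 < t -> is_derive_within (V := R_NormedModule) (Rle 0) f t l -> is_derive f t l.
Proof.
  intros Ht [Hl Hd]; split; [exact Hl|].
  intros x Hx e.
  assert (Hw : is_filter_lim (within (Rle 0) (locally t)) x).
  { intros P HP; specialize (Hx P HP); unfold within; revert Hx; apply filter_imp; auto. }
  pose proof (Hd x Hw e) as H; unfold within in H.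
  assert (Hp : locally t (fun y => 0 <= y)).
  { exists (mkposreal t Ht); intros y Hy; simpl in Hy.
    unfold ball in Hy; simpl in Hy; unfold AbsRing_ball, abs, minus, plus, opp in Hy; simpl in Hy.
    apply Rabs_lt_between in Hy; lra. }
  generalize (filter_and _ _ Hp H); apply filter_imp; intros y [Hy1 Hy2]; exact (Hy2 Hy1).
Qed.

Lemma coord_derive_within (v : R -> l2) (D : R -> Prop) t (l : l2) n :
  is_derive_within (V := l2_NormedModule) D v t l ->
  is_derive_within (V := R_NormedModule) D (fun s => v s n) t (l n).
Proof.
  intros [_ Hd]; split; [exact (is_linear_scal_l (K := R_AbsRing) (V := R_NormedModule) (l n))|].
  intros x Hx e; generalize (Hd x Hx e); apply filter_imp; intros y Hy.
  eapply Rle_trans; [|exact Hy].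
  set (z := minus (minus (v y) (v x)) (scal (minus y x) l)).
  pose proof (l2_coord_le_norm z n) as Hz.
  assert (E : z n = (v y n - v x n) - (y - x) * l n)
    by (unfold z; rewrite !l2_minus_coord; reflexivity).
  rewrite E in Hz; exact Hz.
Qed.

Lemma continuous_coord (n : nat) (x : l2) : continuous (fun y : l2 => y n) x.
Proof.
  intros P [e He]; exists e; intros y Hy; apply He.
  change (l2_norm (minus y x) < e) in Hy.
  change (Rabs (y n - x n) < e).
  pose proof (l2_coord_le_norm (minus y x) n) as Hc; rewrite l2_minus_coord in Hc; lra.
Qed.

Lemma derive_within_continuous {V : NormedModule R_AbsRing} (f f' : R -> V) :
  (forall t, 0 <= t -> is_derive_within (Rle 0) f t (f' t)) -> continuous_on (Rle 0) f.
Proof.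
  intros H t Ht.
  refine (filterdiff_continuous_aux (F := within (Rle 0) (locally t)) f _ t _).
  - eexists; exact (H t Ht).
  - intros P HP; unfold within; revert HP; apply filter_imp; auto.
Qed.

(** A curve continuous on the closed half-line becomes continuous on the whole line after
    [Rmax 0] is applied to the time. *)
Lemma continuous_extend {V : UniformSpace} (f : R -> V) (a s : R) :
  continuous_on (Rle 0) f -> continuous (fun t => f (Rmax 0 (a + t))) s.
Proof.
  intros Hf; apply filterlim_comp with (within (Rle 0) (locally (Rmax 0 (a + s)))).
  - intros P HP; unfold within in HP.
    assert (Hc : continuous (fun t => Rmax 0 (a + t)) s).
    { apply (continuous_ext (fun t => (a + t + Rabs (a + t)) / 2)).
      - intros t; change ((a + t + Rabs (a + t)) / 2 = Rmax 0 (a + t)); unfold Rmax, Rabs;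
          destruct (Rle_dec 0 (a + t)), (Rcase_abs (a + t)); lra.
      - assert (Hs : continuous (fun t => a + t) s).
        { apply (continuous_plus (V := R_NormedModule));
            [apply continuous_const | apply continuous_id]. }
        apply (continuous_mult (K := R_AbsRing)); [|apply continuous_const].
        apply (continuous_plus (V := R_NormedModule)); [exact Hs|].
        apply (continuous_comp (fun t => a + t) Rabs); [exact Hs | apply continuous_Rabs]. }
    generalize (Hc _ HP); unfold filtermap; apply filter_imp; intros t Ht; apply Ht.
    apply Rmax_l.
  - apply Hf, Rmax_l.
Qed.

Lemma is_derive_extend (f : R -> R) a s l :
  0 < a + s -> is_derive f (a + s) l -> is_derive (fun t => f (Rmax 0 (a + t))) s l.
Proof.
  intros Hs Hf.
  apply (is_derive_ext_loc (fun t => f (a + t))).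
  - exists (mkposreal _ Hs); intros t Ht.
    unfold ball in Ht; simpl in Ht; unfold AbsRing_ball, abs, minus, plus, opp in Ht; simpl in Ht.
    apply Rabs_lt_between in Ht; rewrite Rmax_right; [reflexivity | lra].
  - replace l with (scal 1 l) by apply (scal_one (K := R_Ring) l).
    apply (is_derive_comp (K := R_AbsRing) (V := R_NormedModule) f (fun t => a + t));
      [exact Hf | auto_derive; [trivial | ring]].
Qed.

Lemma l2_curve_bounded (v : R -> l2) T :
  0 <= T -> continuous_on (Rle 0) v ->
  exists R0, forall s n, 0 <= s <= T -> Rabs (v (Rmax 0 s) n) <= R0.
Proof.
  intros HT Hv.
  set (f := fun s => norm (v (Rmax 0 (0 + s))) : R).
  destruct (continuity_ab_maj f 0 T HT) as [Mx [HM _]].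
  - intros c Hc; apply continuity_pt_filterlim.
    apply (continuous_comp (fun s => v (Rmax 0 (0 + s))) (fun x : l2 => norm x)).
    + apply (continuous_extend v 0 c Hv).
    + exact (filterlim_norm (V := l2_NormedModule) _).
  - exists (f Mx); intros s n Hs; eapply Rle_trans; [|apply (HM s Hs)].
    unfold f; rewrite Rplus_0_l; exact (l2_coord_le_norm _ n).
Qed.

Lemma cluster_curve_of_l2 alpha beta (v v' : R -> l2) a T :
  0 <= a ->
  (forall t, 0 <= t -> is_derive_within (V := l2_NormedModule) (Rle 0) v t (v' t)) ->
  (forall t n, 0 <= t ->
     v' t (S (S n)) = flux alpha beta (v t) (S n) - flux alpha beta (v t) (S (S n))) ->
  cluster_curve alpha beta T (fun s n => v (Rmax 0 (a + s)) n).
Proof.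
  intros Ha Hd He; split.
  - intros n s; apply (continuous_comp (fun t => v (Rmax 0 (a + t))) (fun y : l2 => y n)).
    + apply (continuous_extend v), (derive_within_continuous (V := l2_NormedModule) v v' Hd).
    + apply continuous_coord.
  - intros n s Hs; rewrite (Rmax_right 0 (a + s)) by lra.
    rewrite <- He by lra.
    apply (is_derive_extend (fun t => v t (S (S n)))); [lra|].
    apply is_derive_of_within; [lra|]; apply coord_derive_within, Hd; lra.
Qed.

(** * The monomer sub-dynamics *)

(** The monomers stay non-negative and can only grow by the release from clusters. *)
Lemma monomer_bounds K B M beta kappa U (w : R -> R) h :
  admissible K B beta -> admissible K B kappa -> bounded_state M U -> 0 <= h ->
  (forall s, 0 <= s <= h -> continuous w s) ->
  (forall s, 0 < s < h -> is_derive w s (monomer_rhs beta kappa U (w s))) ->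
  0 <= w 0 -> 0 <= w h <= w 0 + K * M * h.
Proof.
  intros Hb Hk HU Hh Hc Hd H0.
  pose proof (rate_sum_bounds K B M beta U Hb HU) as S1.
  pose proof (rate_sum_bounds K B M kappa U Hk HU) as S2.
  pose proof (adm_nonneg _ _ _ Hb 1%nat (le_n _)) as b0.
  unfold monomer_rhs in Hd.
  set (b := sum_from_2 (fun n => beta n * U n)) in *.
  set (k := sum_from_2 (fun n => kappa n * U n)) in *.
  assert (Hpos : forall t, 0 <= t <= h -> 0 <= w t).
  { intros t Ht.
    destruct (continuity_ab_maj (fun s => Rabs (w s)) 0 h Hh) as [Mx [HM _]].
    { intros c Hcc; apply continuity_pt_filterlim.
      apply (continuous_comp w Rabs); [apply Hc, Hcc | apply continuous_Rabs]. }
    set (R0 := Rabs (w Mx)) in *; assert (HR0 : 0 <= R0) by apply Rabs_pos.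
    assert (G : Rmin (w t) 0 ^ 2 <= exp (4 * beta 1%nat * R0 * t) * (Rmin (w 0) 0 ^ 2 + 0 * t)).
    { apply (gronwall (fun s => Rmin (w s) 0 ^ 2)); [|lra|lra| |].
      - repeat apply Rmult_le_pos; lra.
      - intros s Hs; apply continuous_neg_sq, Hc; lra.
      - intros s Hs; eexists; split.
        + exact (is_derive_comp (K := R_AbsRing) (V := R_NormedModule)
                   (fun t => Rmin t 0 ^ 2) w s _ _ (is_derive_neg_sq _) (Hd s ltac:(lra))).
        + specialize (HM s ltac:(lra)); apply Rabs_le_between in HM.
          unfold scal; simpl; unfold mult; simpl.
          unfold Rmin; destruct (Rle_dec (w s) 0) as [Hw|Hw].
          * assert (0 <= k * - w s) by (apply Rmult_le_pos; lra).
            assert (0 <= b * (w s * w s)) by (apply Rmult_le_pos; [tauto | nra]).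
            assert (0 <= (beta 1%nat * (w s * w s)) * (R0 + w s))
              by (apply Rmult_le_pos; [apply Rmult_le_pos; [exact b0 | apply Rle_0_sqr] | lra]).
            nra.
          * lra. }
    rewrite (Rmin_right (w 0)) in G by exact H0.
    assert (Hz : Rmin (w t) 0 ^ 2 = 0).
    { apply Rle_antisym; [|apply pow2_ge_0]. eapply Rle_trans; [exact G|]; right; ring. }
    unfold Rmin in Hz; destruct (Rle_dec (w t) 0); [|lra].
    rewrite <- Rsqr_pow2 in Hz; apply Rsqr_0_uniq in Hz; lra. }
  split; [apply Hpos; lra|].
  apply Rle_trans with (exp (0 * h) * (w 0 + K * M * h)).
  - apply gronwall; [lra | lra | exact Hh | exact Hc |].
    intros s Hs; eexists; split; [apply Hd, Hs|].
    assert (0 <= w s) by (apply Hpos; lra).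
    assert (0 <= beta 1%nat * w s ^ 2) by (apply Rmult_le_pos; [exact b0 | apply pow2_ge_0]).
    assert (0 <= b * w s) by (apply Rmult_le_pos; tauto). lra.
  - rewrite Rmult_0_l, exp_0; lra.
Qed.

(** * From tails to the l2 norm *)

Lemma l2_norm_le_tail_err (x y : l2) (D Z : R) :
  (forall N, (1 <= N)%nat -> tail_err N x y <= D + Z / sqrt (INR (S N))) ->
  l2_norm (minus x y) <= 2 * D.
Proof.
  intros H; set (e := minus x y).
  assert (He : forall n, e n = x n - y n) by (intros; apply l2_minus_coord).
  assert (H1 : forall j, Rabs (e 1%nat) + psum (fun n => Rabs (e n)) j <= 2 * D).
  { intros j; apply (le_of_le_sqrt _ _ (2 * Z) (S j)); intros N HN.
    specialize (H N ltac:(lia)); unfold tail_err in H.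
    set (d := tail (cutoff N) (fun n => x n - y n)) in *.
    assert (Hj : psum (fun n => Rabs (e n)) j
                 <= psum (fun n => Rabs (d n)) j + psum (fun n => Rabs (d (S n))) j).
    { rewrite <- psum_plus; apply psum_le; intros i _.
      replace (e (S (S i))) with (d (S (S i)) - d (S (S (S i)))).
      - rewrite <- (Rabs_Ropp (d (S (S (S i))))); apply Rabs_triang.
      - unfold d; rewrite <- tail_diff; symmetry; apply He. }
    pose proof (psum_shift (fun n => Rabs (d (S n))) j) as E; cbv beta in E.
    rewrite (psum_ext _ (fun n => Rabs (d n))) in E by (intros; reflexivity).
    assert (M1 : psum (fun n => Rabs (d n)) (S j) <= psum (fun n => Rabs (d n)) N)
      by (apply psum_mono; [intros; apply Rabs_pos | lia]).
    cbn [psum] in M1.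
    assert (M2 := Rabs_pos (d (S (S j)))); assert (M3 := Rabs_pos (d 2%nat)).
    rewrite He; pose proof (Rabs_pos (x 1%nat - y 1%nat)).
    replace (2 * Z / sqrt (INR (S N))) with (2 * (Z / sqrt (INR (S N)))) by (unfold Rdiv; ring).
    lra. }
  assert (HD : 0 <= 2 * D) by (specialize (H1 0%nat); cbn [psum] in H1; pose proof (Rabs_pos (e 1%nat)); lra).
  assert (H2 : forall j, sum_n (fun n => e n ^ 2) (S j) = e 1%nat ^ 2 + psum (fun n => e n ^ 2) j).
  { induction j as [|j IH].
    - rewrite sum_Sn, sum_O, coord_0; unfold plus; simpl; ring.
    - rewrite sum_Sn, IH; unfold plus; simpl; ring. }
  assert (H3 : forall j, e 1%nat ^ 2 + psum (fun n => e n ^ 2) j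
                         <= (Rabs (e 1%nat) + psum (fun n => Rabs (e n)) j) ^ 2).
  { induction j as [|j IH]; cbn [psum].
    - rewrite !Rplus_0_r, pow2_abs; lra.
    - assert (0 <= psum (fun n => Rabs (e n)) j) by (apply psum_pos; intros; apply Rabs_pos).
      pose proof (Rabs_pos (e 1%nat)); pose proof (Rabs_pos (e (S (S j)))).
      rewrite <- (pow2_abs (e (S (S j)))); nra. }
  unfold l2_norm; rewrite <- (sqrt_square (2 * D)) by exact HD; apply sqrt_le_1_alt.
  assert (Rbar_le (Series (fun n => e n ^ 2)) (2 * D * (2 * D))); [|assumption].
  apply (is_lim_seq_le (fun j => sum_n (fun n => e n ^ 2) (S j)) (fun _ => 2 * D * (2 * D))).
  - intros j; rewrite H2; eapply Rle_trans; [apply H3|].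
    replace (2 * D * (2 * D)) with ((2 * D) ^ 2) by ring; apply pow_incr; split; [|apply H1].
    apply Rplus_le_le_0_compat; [apply Rabs_pos | apply psum_pos; intros; apply Rabs_pos].
  - apply (is_lim_seq_incr_1 (fun j => sum_n (fun n => e n ^ 2) j)).
    exact (Series_correct _ (coord_sq e)).
  - apply is_lim_seq_const.
Qed.

(** * Rates *)

Lemma admissible_of_growth (th : nat -> R) (B gamma K : R) :
  (forall n, (1 <= n)%nat -> 0 <= th n) ->
  (forall n, (1 <= n)%nat -> Rabs (th (n + 1)%nat - th n) <= B) ->
  gamma <= 1 / 2 -> 0 <= K ->
  (forall n, (1 <= n)%nat -> th n <= K * Rpower (INR n) gamma) ->
  admissible K B th.
Proof.
  intros H0 H1 Hg HK H2; split; [exact H0 | |].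
  - intros n Hn; eapply Rle_trans; [apply H2, Hn|]; apply Rmult_le_compat_l; [exact HK|].
    pose proof (INR_ge_1 n Hn); rewrite <- Rpower_sqrt by lra.
    apply Rle_Rpower; [assumption | lra].
  - intros n Hn; replace (S n) with (n + 1)%nat by lia; apply H1, Hn.
Qed.

Lemma admissible_weaken K B K' B' th :
  K <= K' -> B <= B' -> admissible K B th -> admissible K' B' th.
Proof.
  intros HK HB [H0 H1 H2]; split; [exact H0 | |].
  - intros n Hn; eapply Rle_trans; [apply H1, Hn|]; apply Rmult_le_compat_r; [apply sqrt_pos | exact HK].
  - intros n Hn; eapply Rle_trans; [apply H2, Hn | exact HB].
Qed.

(** Rate at which a cluster of size [n] releases monomers: the fragmentation of a dimer
    yields two of them. *)
Definition release (alpha : nat -> R) (n : nat) : R :=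
  alpha n + (if Nat.eqb n 2 then alpha 2%nat else 0).

Lemma admissible_release K B alpha :
  admissible K B alpha -> admissible (2 * K) (B + 2 * K) (release alpha).
Proof.
  intros Ha; pose proof (adm_K_nonneg _ _ _ Ha) as HK.
  pose proof (adm_linear _ _ _ 2 Ha ltac:(lia)) as A2; simpl INR in A2.
  pose proof (adm_nonneg _ _ _ Ha 2 ltac:(lia)) as A0.
  split; intros n Hn; unfold release.
  - pose proof (adm_nonneg _ _ _ Ha n Hn); destruct (Nat.eqb n 2); lra.
  - pose proof (adm_growth _ _ _ Ha n Hn); pose proof (adm_nonneg _ _ _ Ha n Hn).
    destruct (Nat.eqb_spec n 2) as [->|_]; lra.
  - pose proof (adm_incr _ _ _ Ha n Hn) as I; apply Rabs_le_between in I.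
    destruct (Nat.eqb_spec (S n) 2), (Nat.eqb_spec n 2); try lia; apply Rabs_le; lra.
Qed.

Lemma sum_release K B M alpha y :
  admissible K B alpha -> bounded_state M y ->
  sum_from_2 (fun n => release alpha n * y n)
  = sum_from_2 (fun n => alpha n * y n) + alpha 2%nat * y 2%nat.
Proof.
  intros Ha Hy; pose proof (admissible_release _ _ _ Ha) as Hr.
  assert (P : forall K B th, admissible K B th -> ex_series (fun n => th (n + 2)%nat * y (n + 2)%nat)).
  { intros K' B' th Ht; apply (psum_bounded_ex_series (fun n => th n * y n) (K' * M)).
    - intros i; apply (rate_term_bound K' B' M); try assumption; lia.
    - intros k; apply (rate_psum_le K' B'); assumption. }
  unfold sum_from_2.
  rewrite (Series_incr_1 (fun n => release alpha (n + 2)%nat * _)) by exact (P _ _ _ Hr).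
  rewrite (Series_incr_1 (fun n => alpha (n + 2)%nat * _)) by exact (P _ _ _ Ha).
  rewrite (Series_ext (fun k => release alpha (S k + 2) * _) (fun k => alpha (S k + 2)%nat * y (S k + 2)%nat)).
  - unfold release; simpl; ring.
  - intros k; unfold release; destruct (Nat.eqb_spec (S k + 2) 2); [lia | ring].
Qed.

(** * Moment bounds for the solution and for the scheme *)

Lemma Rmax_shift0 s : 0 <= s -> Rmax 0 (0 + s) = s.
Proof. intros H; rewrite Rplus_0_l; apply Rmax_right, H. Qed.

Lemma inQ_moment (x : l2) : inQ x -> exists m, forall k, psum (fun n => INR n * x n) k <= m.
Proof.
  intros [Hx Hs].
  assert (Hex : ex_series (fun n => INR (n + 2) * x (n + 2)%nat)).
  { apply (ex_series_ext_R (fun k => INR (2 + k) * x (2 + k)%nat)).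
    - intros n; rewrite Nat.add_comm; reflexivity.
    - exact (proj1 (ex_series_incr_n (fun n => INR n * x n) 2) Hs). }
  exists (sum_from_2 (fun n => INR n * x n)); intros k.
  apply (is_lim_seq_incr_compare (psum (fun n => INR n * x n))).
  - apply (ex_series_is_lim_psum (fun n => INR n * x n)); exact Hex.
  - intros j; cbn [psum]; pose proof (Hx (S (S j)) ltac:(lia)); pose proof (pos_INR (S (S j))); nra.
Qed.

Lemma linear_form_flux alpha beta (y : nat -> R) n :
  beta (S (S n) - 1)%nat * y 1%nat * y (S (S n) - 1)%nat
  - (beta (S (S n)) * y 1%nat + alpha (S (S n))) * y (S (S n))
  + alpha (S (S n) + 1)%nat * y (S (S n) + 1)%nat
  = flux alpha beta y (S n) - flux alpha beta y (S (S n)).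
Proof.
  replace (S (S n) - 1)%nat with (S n) by lia; replace (S (S n) + 1)%nat with (S (S (S n))) by lia.
  unfold flux; ring.
Qed.

(** Uniform state bound on [0, tau] and equations of the exact solution. *)
Lemma solution_facts K B alpha beta (u0 : l2) (u : R -> l2) tau :
  admissible K B alpha -> admissible K B beta -> inQ u0 -> 0 <= tau ->
  is_BD_solution alpha beta u0 u ->
  (exists M0, forall s, 0 <= s <= tau -> bounded_state M0 (u s)) /\
  (forall a T, 0 <= a ->
     cluster_curve alpha beta T (fun s n => u (Rmax 0 (a + s)) n)) /\
  (forall M s, 0 < s -> bounded_state M (u s) ->
     is_derive (fun t => u t 1%nat) s (monomer_rhs beta (release alpha) (u s) (u s 1%nat))).
Proof.
  intros Ha Hb H0 Ht [Hu0 [HuQ [Huc [u' [[Hd _] He]]]]].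
  assert (Hcc : forall a T, 0 <= a ->
     cluster_curve alpha beta T (fun s n => u (Rmax 0 (a + s)) n)).
  { intros a T HaT; apply (cluster_curve_of_l2 alpha beta u u'); [exact HaT | exact Hd |].
    intros t n Htn; rewrite <- linear_form_flux.
    destruct (He t Htn) as [_ E]; rewrite (E (S (S n)) ltac:(lia)); ring. }
  split; [|split; [exact Hcc|]].
  - destruct (l2_curve_bounded u tau Ht Huc) as [R0 HR].
    destruct (inQ_moment u0 H0) as [m0 Hm0].
    assert (HR' : forall s n, 0 <= s <= tau -> (1 <= n)%nat -> 0 <= u s n <= R0).
    { intros s n Hs Hn; split; [apply (HuQ s (proj1 Hs)), Hn|].
      specialize (HR s n Hs); rewrite Rmax_right in HR by lra.
      eapply Rle_trans; [apply Rle_abs | exact HR]. }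
    assert (HR0 : 0 <= R0) by (pose proof (HR' 0 1%nat ltac:(lra) (le_n _)); lra).
    pose proof (adm_K_nonneg _ _ _ Ha) as HK.
    assert (Hm0' : 0 <= m0) by (specialize (Hm0 0%nat); simpl in Hm0; exact Hm0).
    set (Mu := exp ((R0 + 2) * K * tau) * (m0 + 2 * R0 ^ 2 * K * tau)).
    assert (HK2 : 0 <= 2 * R0 ^ 2 * K) by (pose proof (pow2_ge_0 R0); nra).
    assert (HMu : 0 <= Mu).
    { apply Rmult_le_pos; [left; apply exp_pos|]; apply Rplus_le_le_0_compat; [exact Hm0'|].
      apply Rmult_le_pos; assumption. }
    exists (R0 + Mu); intros s Hs; split.
    + intros n Hn; apply HR'; assumption.
    + pose proof (HR' s 1%nat Hs (le_n _)); lra.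
    + intros k.
      apply Rle_trans with (exp ((R0 + 2) * K * s) * (m0 + 2 * R0 ^ 2 * K * s)).
      * pose proof (cluster_curve_moment K B alpha beta s R0 R0 m0
                      (fun s n => u (Rmax 0 (0 + s)) n) Ha Hb (Hcc 0 s ltac:(lra))) as P.
        cbv beta in P; rewrite !Rmax_shift0 in P by lra; apply P.
        -- intros r Hr; rewrite Rmax_shift0 by lra; apply HR'; [lra | lia].
        -- intros r n Hr Hn; rewrite Rmax_shift0 by lra; apply HR'; [lra | exact Hn].
        -- rewrite Hu0; exact Hm0.
        -- lra.
      * apply Rle_trans with Mu; [|lra]; unfold Mu; apply Rmult_le_compat.
        -- left; apply exp_pos.
        -- apply Rplus_le_le_0_compat; [exact Hm0' | apply Rmult_le_pos; lra].
        -- assert ((R0 + 2) * K * s <= (R0 + 2) * K * tau).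
           { apply Rmult_le_compat_l; [apply Rmult_le_pos; lra | lra]. }
           apply exp_mono; assumption.
        -- assert (2 * R0 ^ 2 * K * s <= 2 * R0 ^ 2 * K * tau)
             by (apply Rmult_le_compat_l; lra). lra.
  - intros M s Hs HM.
    apply is_derive_of_within; [exact Hs|].
    destruct (He s ltac:(lra)) as [E _].
    replace (monomer_rhs beta (release alpha) (u s) (u s 1%nat)) with (u' s 1%nat).
    + apply coord_derive_within, Hd; lra.
    + rewrite E; unfold monomer_rhs.
      rewrite (sum_release K B M alpha (u s) Ha HM).
      assert (P : sum_from_2 (fun n => beta n * u s n * u s 1%nat)
                  = sum_from_2 (fun n => beta n * u s n) * u s 1%nat).
      { unfold sum_from_2; rewrite Rmult_comm, <- Series_scal_l.
        apply Series_ext; intros n; ring. }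
      rewrite P; ring.
Qed.

(** Regularity, positivity and moment growth for the cluster sub-dynamics. *)
Lemma chi_facts K B alpha beta c C (x : l2) (v : R -> l2) m0 :
  admissible K B alpha -> admissible K B beta -> 0 <= c <= C ->
  (forall n, (1 <= n)%nat -> 0 <= x n) ->
  (forall k, psum (fun n => INR n * x n) k <= m0) ->
  is_chi_solution alpha beta c x v ->
  (forall T, cluster_curve alpha beta T (fun s n => v (Rmax 0 (0 + s)) n)) /\
  (forall s n, 0 <= s -> (1 <= n)%nat -> 0 <= v s n) /\
  (forall s k, 0 <= s -> psum (fun n => INR n * v s n) k
     <= exp ((C + 2) * K * s) * (m0 + 2 * C ^ 2 * K * s)).
Proof.
  intros Ha Hb Hc Hx Hm [Hv0 [Hv1 [v' [[Hd _] He]]]].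
  assert (Hcc : forall T, cluster_curve alpha beta T (fun s n => v (Rmax 0 (0 + s)) n)).
  { intros T; apply (cluster_curve_of_l2 alpha beta v v'); [lra | exact Hd |].
    intros t n Htn; rewrite <- linear_form_flux, (Hv1 t Htn); apply (He t Htn); lia. }
  pose proof (derive_within_continuous (V := l2_NormedModule) v v' Hd) as Hvc.
  assert (Hpos : forall s n, 0 <= s -> (1 <= n)%nat -> 0 <= v s n).
  { intros s n Hs Hn; destruct (l2_curve_bounded v s Hs Hvc) as [R0 HR].
    pose proof (cluster_curve_nonneg K B alpha beta s C R0
                  (fun s n => v (Rmax 0 (0 + s)) n) Ha Hb (Hcc s)) as P.
    cbv beta in P; rewrite !Rmax_shift0 in P by lra; apply P; try assumption.
    - intros r Hr; rewrite Rmax_shift0, Hv1 by lra; exact Hc.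
    - intros r j Hr Hj; rewrite Rplus_0_l; apply HR, Hr.
    - intros j Hj; destruct j as [|[|j]]; [lia | rewrite Hv1 by lra; tauto |].
      rewrite Hv0 by lia; apply Hx; lia. }
  split; [exact Hcc | split; [exact Hpos|]].
  intros s k Hs; destruct (l2_curve_bounded v s Hs Hvc) as [R0 HR].
  pose proof (cluster_curve_moment K B alpha beta s C R0 m0
                (fun s n => v (Rmax 0 (0 + s)) n) Ha Hb (Hcc s)) as P.
  cbv beta in P; rewrite !Rmax_shift0 in P by lra; apply P; try assumption.
  - intros r Hr; rewrite Rmax_shift0, Hv1 by lra; exact Hc.
  - intros r j Hr Hj; rewrite Rmax_shift0 by lra; split; [apply Hpos; [lra | exact Hj]|].
    specialize (HR r j Hr); rewrite Rmax_right in HR by lra.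
    eapply Rle_trans; [apply Rle_abs | exact HR].
  - intros j; rewrite (psum_ext _ (fun n => INR n * x n)); [apply Hm|].
    intros i; rewrite Hv0 by lia; reflexivity.
Qed.

Lemma phi_facts K B M alpha beta (x : l2) (w : R -> R) :
  admissible K B alpha -> bounded_state M x -> is_phi_solution alpha beta x w ->
  (forall s, continuous (fun t => w (Rmax 0 (0 + t))) s) /\
  (forall s, 0 < s -> is_derive (fun t => w (Rmax 0 (0 + t))) s
     (monomer_rhs beta (release alpha) x (w (Rmax 0 (0 + s))))).
Proof.
  intros Ha Hx [_ Hd]; split.
  - intros s; apply (continuous_extend (V := R_UniformSpace)).
    exact (derive_within_continuous (V := R_NormedModule) w _ Hd).
  - intros s Hs; rewrite Rmax_shift0 by lra; apply is_derive_extend; [lra|].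
    rewrite Rplus_0_l; apply is_derive_of_within; [exact Hs|].
    unfold monomer_rhs; rewrite (sum_release K B M alpha x Ha Hx); apply Hd; lra.
Qed.

Lemma exp_grow A a b x y :
  0 <= A -> 0 <= a -> 0 <= y ->
  exp (A * b) * (exp (A * a) * x + y) <= exp (A * (a + b)) * (x + y).
Proof.
  intros HA Ha Hy.
  replace (A * (a + b)) with (A * b + A * a) by ring; rewrite exp_plus, Rmult_assoc.
  apply Rmult_le_compat_l; [left; apply exp_pos|].
  assert (1 <= exp (A * a)).
  { rewrite <- exp_0; assert (H : 0 <= A * a) by (apply Rmult_le_pos; assumption).
    apply exp_mono, H. }
  nra.
Qed.

Lemma tail_ext p e e' i :
  (forall n, (2 <= n)%nat -> e n = e' n) -> tail p e (S (S i)) = tail p e' (S (S i)).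
Proof.
  intros H; unfold tail; rewrite !(psum_ext e e') by (intros j; apply H; lia); reflexivity.
Qed.

(** * Convergence *)

(** Error bound at every step, up to a truncation error vanishing as [N] tends to infinity.
    The induction propagates positivity, the moment bound and the error bound together. *)
Lemma splitting_error K B alpha beta (u0 : l2) (u : R -> l2) tau :
  admissible K B alpha -> admissible K B beta -> admissible K B (release alpha) ->
  inQ u0 -> 0 < tau -> is_BD_solution alpha beta u0 u ->
  exists L h0, 0 <= L /\ 0 < h0 /\
    forall h, 0 < h <= h0 -> forall U, splitting_iterates alpha beta h u0 U ->
    forall k, INR k * h <= tau ->
    exists Z, forall N, (1 <= N)%nat ->
      tail_err N (u (INR k * h)) (U k) <= L * h + Z / sqrt (INR (S N)).
Proof.
  intros Ha Hb Hk H0 Htau Hu.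
  destruct (solution_facts K B alpha beta u0 u tau Ha Hb H0 ltac:(lra) Hu)
    as [[M0 HM0] [Hcc Hu1]].
  destruct (inQ_moment u0 H0) as [m0 Hm0].
  assert (Hm0' : 0 <= m0) by (specialize (Hm0 0%nat); simpl in Hm0; exact Hm0).
  pose proof (adm_K_nonneg _ _ _ Ha) as HK; pose proof (adm_B_nonneg _ _ _ Ha) as HB.
  assert (HM0' : 0 <= M0) by (apply (bs_M_nonneg _ (u 0)), HM0; lra).
  (* As long as the error is at most 1 the numerical monomers stay below [cb], hence the
     numerical moments stay below [mb]. *)
  set (cb := M0 + 2); set (A := (cb + 2) * K); set (Dm := 2 * cb ^ 2 * K).
  assert (HA : 0 <= A) by (apply Rmult_le_pos; unfold cb; lra).
  assert (HDm : 0 <= Dm) by (unfold Dm; pose proof (pow2_ge_0 cb); nra).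
  set (mb := exp (A * tau) * (m0 + Dm * tau)).
  assert (Hmt : forall t, 0 <= t <= tau -> exp (A * t) * (m0 + Dm * t) <= mb).
  { intros t Ht; unfold mb; apply Rmult_le_compat.
    - left; apply exp_pos.
    - apply Rplus_le_le_0_compat; [exact Hm0' | apply Rmult_le_pos; lra].
    - apply exp_mono, Rmult_le_compat_l; lra.
    - apply Rplus_le_compat_l, Rmult_le_compat_l; lra. }
  assert (Hmb : 0 <= mb).
  { apply Rmult_le_pos; [left; apply exp_pos|].
    apply Rplus_le_le_0_compat; [exact Hm0' | apply Rmult_le_pos; lra]. }
  set (M := cb + mb); set (C := step_const K B M).
  assert (HM : 0 <= M) by (unfold M, cb; lra).
  pose proof (step_const_nonneg K B M HK HB HM) as HC; fold C in HC.
  set (L := exp (C * tau) * (C * tau)).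
  assert (HL : 0 <= L).
  { apply Rmult_le_pos; [left; apply exp_pos | apply Rmult_le_pos; lra]. }
  assert (HKM : 0 <= K * M) by (apply Rmult_le_pos; assumption).
  set (h0 := / (1 + K * M + L)).
  assert (Hh0 : 0 < h0) by (apply Rinv_0_lt_compat; lra).
  exists L, h0; split; [exact HL | split; [exact Hh0|]].
  intros h [Hh Hhh] U [HU0 HUS].
  assert (Hsmall : (1 + K * M + L) * h <= 1).
  { apply Rle_trans with ((1 + K * M + L) * h0); [apply Rmult_le_compat_l; lra|].
    right; unfold h0; apply Rinv_r; lra. }
  assert (HLh0 : 0 <= L * h) by (apply Rmult_le_pos; lra).
  assert (HKMh0 : 0 <= K * M * h) by (apply Rmult_le_pos; lra).
  assert (HKMh : K * M * h <= 1) by lra.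
  assert (HLh : L * h <= 1) by lra.
  set (D := fun t => exp (C * t) * (C * t * h)).
  assert (HD : forall t, 0 <= t <= tau -> D t <= L * h).
  { intros t Ht; unfold D, L; rewrite (Rmult_assoc (exp _) (C * tau)).
    assert (C * t <= C * tau) by (apply Rmult_le_compat_l; lra).
    assert (0 <= C * t) by (apply Rmult_le_pos; lra).
    apply Rmult_le_compat; [left; apply exp_pos | apply Rmult_le_pos; lra | apply exp_mono; lra |].
    apply Rmult_le_compat_r; lra. }
  assert (Main : forall k, INR k * h <= tau ->
    (forall n, (1 <= n)%nat -> 0 <= U k n) /\
    (forall j, psum (fun n => INR n * U k n) j
               <= exp (A * (INR k * h)) * (m0 + Dm * (INR k * h))) /\
    exists Z, forall N, (1 <= N)%nat ->
      tail_err N (u (INR k * h)) (U k) <= D (INR k * h) + Z / sqrt (INR (S N))).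
  { induction k as [|k IH].
    - intros _; simpl INR; rewrite Rmult_0_l, HU0; split; [apply H0|split].
      + intros j; rewrite !Rmult_0_r, exp_0, Rplus_0_r, Rmult_1_l; apply Hm0.
      + exists 0; intros N _; unfold D; rewrite !Rmult_0_r, Rmult_0_l, Rmult_0_r.
        destruct Hu as [E _]; unfold tail_err; rewrite E, Rminus_diag, Rabs_R0.
        rewrite (psum_ext _ (fun _ => 0)).
        * rewrite psum_const; unfold Rdiv; lra.
        * intros i; rewrite (tail_ext _ _ (fun _ => 0)) by (intros; apply Rminus_diag).
          unfold tail; rewrite !psum_const; rewrite !Rmult_0_r, Rminus_0_r; apply Rabs_R0.
    - intros HkS; rewrite S_INR in *.
      set (t := INR k * h) in *.
      replace ((INR k + 1) * h) with (t + h) in * by (unfold t; ring).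
      assert (Ht : 0 <= t) by (apply Rmult_le_pos; [apply pos_INR | lra]).
      destruct IH as [Upos [Umom [Z HZ]]]; [lra|].
      destruct (HUS k) as [w [v [Hphi [Hchi Hv]]]].
      (* The error is at most 1, so the numerical monomers are close to the exact ones. *)
      assert (HU1 : U k 1%nat <= M0 + 1).
      { assert (Hd1 : Rabs (u t 1%nat - U k 1%nat) <= D t).
        { apply (le_of_le_sqrt _ _ Z 1); intros N HN.
          eapply Rle_trans; [|apply (HZ N HN)]; unfold tail_err.
          pose proof (psum_pos (fun n => Rabs (tail (cutoff N) (fun n => u t n - U k n) n)) N
                        (fun i => Rabs_pos _)); lra. }
        pose proof (HD t ltac:(lra)); pose proof (bs_first _ _ (HM0 t ltac:(lra))).
        apply Rabs_le_between in Hd1; lra. }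
      assert (HUb : bounded_state M (U k)).
      { split; [exact Upos | unfold M, cb; lra |].
        intros j; eapply Rle_trans; [apply Umom|].
        eapply Rle_trans; [apply Hmt; lra | unfold M, cb; lra]. }
      destruct (phi_facts K B M alpha beta (U k) w Ha HUb Hphi) as [Wc Wd].
      assert (Ww : forall s, 0 <= s <= h -> 0 <= w s <= cb).
      { intros s Hs.
        pose proof (monomer_bounds K B M beta (release alpha) (U k)
                      (fun t => w (Rmax 0 (0 + t))) s Hb Hk HUb (proj1 Hs)
                      (fun r _ => Wc r) (fun r Hr => Wd r (proj1 Hr))) as P.
        cbv beta in P; rewrite !Rmax_shift0 in P by lra.
        rewrite (proj1 Hphi) in P; specialize (P (Upos 1%nat (le_n _))).
        assert (K * M * s <= K * M * h) by (apply Rmult_le_compat_l; lra).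
        unfold cb; lra. }
      destruct (chi_facts K B alpha beta (w h) cb (U k) v _ Ha Hb (Ww h ltac:(lra))
                  Upos Umom Hchi) as [Vcc [Vpos Vmom]].
      fold A Dm in Vmom.
      assert (Vmom' : forall s j, 0 <= s -> psum (fun n => INR n * v s n) j
                 <= exp (A * (t + s)) * (m0 + Dm * (t + s))).
      { intros s j Hs; eapply Rle_trans; [apply (Vmom s j Hs)|].
        replace (m0 + Dm * (t + s)) with (m0 + Dm * t + Dm * s) by ring.
        apply exp_grow; try assumption; apply Rmult_le_pos; assumption. }
      destruct Hchi as [Hv0 [Hv1 _]].
      assert (HVb : forall s, 0 <= s <= h -> bounded_state M (v s)).
      { intros s Hs; split; [intros n Hn; apply Vpos; [lra | exact Hn] | |].
        - rewrite Hv1 by lra; pose proof (Ww h ltac:(lra)); unfold M; lra.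
        - intros j; eapply Rle_trans; [apply Vmom'; lra|].
          eapply Rle_trans; [apply Hmt; lra | unfold M, cb; lra]. }
      assert (HXb : forall s, 0 <= s <= h -> bounded_state M (u (t + s))).
      { intros s Hs; destruct (HM0 (t + s) ltac:(lra)) as [X0 X1 X2]; split; [exact X0 | |].
        - unfold M, cb; lra.
        - intros j; eapply Rle_trans; [apply X2 | unfold M, cb; lra]. }
      rewrite Hv; split; [intros n Hn; apply Vpos; [lra | exact Hn] | split].
      + intros j; apply Vmom'; lra.
      + exists (exp (C * h) * (Z + 1 + C * h)); intros N HN.
        pose proof (one_step K B M alpha beta (release alpha) h
          (fun s n => u (Rmax 0 (t + s)) n) (fun s n => v (Rmax 0 (0 + s)) n)
          (fun s => w (Rmax 0 (0 + s))) N Ha Hb Hk (Hcc t h Ht) (Vcc h) ltac:(lra)) as P.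
        cbv beta zeta in P; fold C in P.
        rewrite !Rmax_shift0, Rplus_0_r, !(Rmax_right 0) in P by lra.
        assert (P' : Rabs (u (t + h) 1%nat - w h)
            + psum (fun n => Rabs (tail (cutoff N) (fun n => u (t + h) n - v h n) n)) N
          <= exp (C * h) * (Rabs (u t 1%nat - w 0)
            + psum (fun n => Rabs (tail (cutoff N) (fun n => u t n - v 0 n) n)) N
            + / sqrt (INR (S N)) + C * (h + / sqrt (INR (S N))) * h)).
        { apply P; clear P; try assumption.
          - intros s Hs; rewrite Rmax_right by lra; apply HXb, Hs.
          - intros s Hs; rewrite Rmax_shift0 by lra; apply HVb, Hs.
          - intros s Hs; rewrite Rmax_shift0 by lra; pose proof (Ww s Hs); unfold M; lra.
          - intros s _; apply Wc.
          - intros s Hs.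
            replace (monomer_rhs beta (release alpha) (fun n => v 0 n))
              with (monomer_rhs beta (release alpha) (U k)); [apply Wd; lra|].
            unfold monomer_rhs, sum_from_2.
            rewrite (Series_ext (fun n => beta (n + 2)%nat * v 0 (n + 2)%nat)
                       (fun n => beta (n + 2)%nat * U k (n + 2)%nat))
              by (intros n; rewrite Hv0 by lia; reflexivity).
            rewrite (Series_ext (fun n => release alpha (n + 2)%nat * v 0 (n + 2)%nat)
                       (fun n => release alpha (n + 2)%nat * U k (n + 2)%nat))
              by (intros n; rewrite Hv0 by lia; reflexivity).
            reflexivity.
          - intros s Hs; rewrite (Rmax_right 0 (t + s)) by lra.
            apply (is_derive_extend (fun r => u r 1%nat)); [lra|].
            apply (Hu1 M); [lra | apply HXb; lra].
          - intros s Hs; rewrite Rmax_shift0 by lra; apply Hv1; lra. }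
        assert (E0 : psum (fun n => Rabs (tail (cutoff N) (fun n => u t n - v 0 n) n)) N
                   = psum (fun n => Rabs (tail (cutoff N) (fun n => u t n - U k n) n)) N).
        { apply psum_ext; intros i; f_equal; apply tail_ext; intros n Hn.
          rewrite Hv0 by exact Hn; reflexivity. }
        rewrite E0, (proj1 Hphi) in P'; clear E0 P.
        specialize (HZ N HN); unfold tail_err in HZ.
        unfold tail_err; rewrite (Hv1 h ltac:(lra)).
        eapply Rle_trans; [exact P'|].
        unfold Rdiv in *; set (r := / sqrt (INR (S N))) in *.
        apply Rle_trans with (exp (C * h) * (D t + C * h * h)
                              + exp (C * h) * (Z + 1 + C * h) * r).
        * replace (exp (C * h) * (D t + C * h * h) + exp (C * h) * (Z + 1 + C * h) * r)
            with (exp (C * h) * (D t + Z * r + r + C * (h + r) * h)) by ring.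
          apply Rmult_le_compat_l; [left; apply exp_pos | lra].
        * apply Rplus_le_compat_r; unfold D.
          replace (C * (t + h) * h) with (C * t * h + C * h * h) by ring.
          apply exp_grow; [exact HC | exact Ht |].
          apply Rmult_le_pos; [apply Rmult_le_pos; lra | lra]. }
  intros k Hkt; destruct (Main k Hkt) as [_ [_ [Z HZ]]]; exists Z; intros N HN.
  eapply Rle_trans; [apply (HZ N HN)|]; apply Rplus_le_compat_r, HD.
  split; [apply Rmult_le_pos; [apply pos_INR | lra] | exact Hkt].
Qed.

Theorem proposition3
  (alpha beta : nat -> R)
  (Hnonneg : forall n, (1 <= n)%nat -> 0 <= alpha n /\ 0 <= beta n)
  (B : R) (HB : 0 <= B)
  (Hincr : forall n, (1 <= n)%nat ->
     Rabs (alpha (n + 1)%nat - alpha n) <= B /\ Rabs (beta (n + 1)%nat - beta n) <= B)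
  (gamma K : R) (Hgamma : 0 <= gamma <= 1 / 2) (HK : 0 < K)
  (Hgrowth : forall n, (1 <= n)%nat ->
     alpha n <= K * Rpower (INR n) gamma /\ beta n <= K * Rpower (INR n) gamma)
  (u0 : l2) (Hu0 : inQ u0) (Hu01 : 0 < u0 1%nat)
  (tau : R) (Htau : 0 < tau)
  (Hu0k : exists k, (2 <= k)%nat /\ 0 < u0 k)
  (u : R -> l2) (Hu : is_BD_solution alpha beta u0 u) :
  exists L dtstar : R, 0 <= L /\ 0 < dtstar /\
    forall dt : R, 0 < dt <= dtstar ->
    forall U : nat -> l2, splitting_iterates alpha beta dt u0 U ->
    forall n : nat, INR n <= tau / dt ->
      norm (minus (u (INR n * dt)) (U n)) <= L * dt.
Proof.
  assert (Ha : admissible K B alpha).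
  { apply (admissible_of_growth alpha B gamma); try lra; intros n Hn;
      [apply Hnonneg | apply Hincr | apply Hgrowth]; exact Hn. }
  assert (Hb : admissible K B beta).
  { apply (admissible_of_growth beta B gamma); try lra; intros n Hn;
      [apply Hnonneg | apply Hincr | apply Hgrowth]; exact Hn. }
  destruct (splitting_error (2 * K) (B + 2 * K) alpha beta u0 u tau) as [L [h0 [HL [Hh0 H]]]];
    try assumption.
  - apply (admissible_weaken K B); [lra | lra | exact Ha].
  - apply (admissible_weaken K B); [lra | lra | exact Hb].
  - apply admissible_release, Ha.
  - exists (2 * L), h0; split; [lra | split; [exact Hh0|]].
    intros dt Hdt U HU n Hn.
    destruct (H dt Hdt U HU n) as [Z HZ].
    + apply (Rmult_le_compat_r dt) in Hn; [|lra].
      unfold Rdiv in Hn; rewrite Rmult_assoc, Rinv_l in Hn by lra; lra.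
    + rewrite Rmult_assoc; exact (l2_norm_le_tail_err _ _ _ Z HZ).
Qed.
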